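(* Let $X$ be a smooth quasi-projective variety, $D\subseteq X$ any effective divisor, $L=\mathcal{O}_X(D)$, and $n$ a positive integer. Then the rank $n$ vector bundle $L^{[n]}$ on the Hilbert scheme $\mathrm{Hilb}^n(X)$ has a tautological section $\sigma$ (the one induced by a section $s\in H^0(X,L)$ defining $D$) whose zero locus $\sigma^{-1}(0)\subseteq \mathrm{Hilb}^n(X)$ is isomorphic, as a scheme, to the Hilbert scheme $\mathrm{Hilb}^n(D)$ of $n$ points on $D$, where $\mathrm{Hilb}^n(D)\to\mathrm{Hilb}^n(X)$ sends $Z\subseteq D$ to $Z\subseteq X$.
   Context: Varieties are over $\mathbb{C}$. $\mathrm{Hilb}^n(Y)$ is the Hilbert scheme of $n$ points on $Y$ (zero-dimensional subschemes of length $n$). Let $\mathcal{Z}\subseteq \mathrm{Hilb}^n(X)\times X$ be the universal subscheme, with projections $p:\mathcal{Z}\to\mathrm{Hilb}^n(X)$ (finite flat of degree $n$) and $q:\mathcal{Z}\to X$. For a line bundle $L$ on $X$, the tautological bundle is $L^{[n]}:=p_*q^*L$, with fibre $H^0(L|_Z)$ over $Z\in\mathrm{Hilb}^n(X)$. A section $s$ of $L$ induces the tautological section $p_*q^*s$ of $L^{[n]}$, whose value at $Z$ is $s|_Z$. *)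

(* Defs.v *)
(* Schemes over a field k are handled through their functors of points, in the
   style of Demazure and Gabriel: a scheme is a Zariski-local functor on
   commutative k-algebras that is covered by open affine subfunctors.
   Algebras may be the zero ring (comPzRingType), so that closed subschemes,
   localizations and fibres are never artificially excluded. *)
From HB Require Import structures.
From mathcomp Require Import all_boot all_order all_algebra.
From mathcomp Require Import boolp reals complex.

Set Implicit Arguments.
Unset Strict Implicit.
Unset Printing Implicit Defensive.

Import GRing.Theory.
Local Open Scope ring_scope.

Record kAlg (k : fieldType) := KAlg {
  kAlg_ring :> comPzRingType;
  kAlg_str : {rmorphism k -> kAlg_ring} }.
Arguments KAlg {k kAlg_ring} kAlg_str.

Record kHom (k : fieldType) (A B : kAlg k) := KHom {
  kHom_fun :> A -> B;
  kHom_zmod : zmod_morphism kHom_fun;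
  kHom_monoid : monoid_morphism kHom_fun;
  kHom_str : forall c : k, kHom_fun (kAlg_str A c) = kAlg_str B c }.

HB.instance Definition _ (k : fieldType) (A B : kAlg k) (f : kHom A B) :=
  GRing.isZmodMorphism.Build A B f (kHom_zmod f).
HB.instance Definition _ (k : fieldType) (A B : kAlg k) (f : kHom A B) :=
  GRing.isMonoidMorphism.Build A B f (kHom_monoid f).

Lemma kHom_eq (k : fieldType) (A B : kAlg k) (f g : kHom A B) :
  (forall a, f a = g a) -> f = g.
Proof.
case: f => f f1 f2 f3; case: g => g g1 g2 g3 /= fg.
have {}fg : f = g by apply: funext.
case: _ / fg g1 g2 g3 => g1 g2 g3.
by congr KHom; apply: Prop_irrelevance.
Qed.

Section KHom.
Variables (k : fieldType) (A B C : kAlg k).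

Lemma kid_zmod : zmod_morphism (fun a : A => a). Proof. by []. Qed.
Lemma kid_monoid : monoid_morphism (fun a : A => a). Proof. by []. Qed.
Definition kid : kHom A A :=
  @KHom k A A (fun a => a) kid_zmod kid_monoid (fun=> erefl).

Variables (g : kHom B C) (f : kHom A B).
Lemma kcomp_zmod : zmod_morphism (fun a => g (f a)).
Proof. by move=> a b; rewrite !rmorphB. Qed.
Lemma kcomp_monoid : monoid_morphism (fun a => g (f a)).
Proof. by split=> [|a b]; rewrite ?rmorph1 ?rmorphM. Qed.
Lemma kcomp_str c : g (f (kAlg_str A c)) = kAlg_str C c.
Proof. by rewrite !kHom_str. Qed.
Definition kcomp : kHom A C :=
  @KHom k A C (fun a => g (f a)) kcomp_zmod kcomp_monoid kcomp_str.
End KHom.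
Arguments kid {k} A.

Record kfun (k : fieldType) := KFun {
  pt :> kAlg k -> Type;
  ptmap : forall A B, kHom A B -> pt A -> pt B;
  ptmap_id : forall A (x : pt A), ptmap (kid A) x = x;
  ptmap_comp : forall A B C (g : kHom B C) (f : kHom A B) (x : pt A),
    ptmap (kcomp g f) x = ptmap g (ptmap f x) }.

Record kmor (k : fieldType) (X Y : kfun k) := KMor {
  mor :> forall A, X A -> Y A;
  mor_nat : forall A B (f : kHom A B) (x : X A),
    mor (ptmap f x) = ptmap f (mor x) }.
Arguments mor {k X Y} _ A _ : rename.

Definition is_iso (k : fieldType) (X Y : kfun k) (f : kmor X Y) : Prop :=
  exists g : kmor Y X, (forall A (x : X A), g A (f A x) = x) /\
                       (forall A (y : Y A), f A (g A y) = y).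

Section Spec.
Variables (k : fieldType) (A : kAlg k).
Lemma spec_id B (x : kHom A B) : kcomp (kid B) x = x.
Proof. exact: kHom_eq. Qed.
Lemma spec_comp B C D (g : kHom C D) (f : kHom B C) (x : kHom A B) :
  kcomp (kcomp g f) x = kcomp g (kcomp f x).
Proof. exact: kHom_eq. Qed.
Definition Spec : kfun k := KFun spec_id spec_comp.
End Spec.

Section Prod.
Variables (k : fieldType) (X Y : kfun k).
Definition prod_map A B (f : kHom A B) (u : X A * Y A) : X B * Y B :=
  (ptmap f u.1, ptmap f u.2).
Lemma prod_id A (u : X A * Y A) : prod_map (kid A) u = u.
Proof. by case: u => x y; rewrite /prod_map !ptmap_id. Qed.
Lemma prod_comp A B C (g : kHom B C) (f : kHom A B) (u : X A * Y A) :
  prod_map (kcomp g f) u = prod_map g (prod_map f u).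
Proof. by rewrite /prod_map !ptmap_comp. Qed.
Definition kprod : kfun k := KFun prod_id prod_comp.
End Prod.

Record sub (k : fieldType) (X : kfun k) := Sub {
  sub_pred :> forall A, X A -> Prop;
  sub_stable : forall A B (f : kHom A B) (x : X A),
    sub_pred x -> sub_pred (ptmap f x) }.
Arguments sub_pred {k X} s {A} _.

Section SubFun.
Variables (k : fieldType) (X : kfun k) (D : sub X).
Definition sfun_map A B (f : kHom A B) (x : {x : X A | D A x}) :
  {x : X B | D B x} := exist _ (ptmap f (sval x)) (sub_stable f (svalP x)).
Lemma sfun_eq A (x y : {x : X A | D A x}) : sval x = sval y -> x = y.
Proof.
case: x y => x Dx [y Dy] /= e; case: _ / e Dy => Dy.
by congr exist; apply: Prop_irrelevance.
Qed.
Lemma sfun_id A (x : {x : X A | D A x}) : sfun_map (kid A) x = x.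
Proof. by apply: sfun_eq; rewrite /= ptmap_id. Qed.
Lemma sfun_comp A B C (g : kHom B C) (f : kHom A B) (x : {x : X A | D A x}) :
  sfun_map (kcomp g f) x = sfun_map g (sfun_map f x).
Proof. by apply: sfun_eq; rewrite /= ptmap_comp. Qed.
Definition sfun : kfun k := KFun sfun_id sfun_comp.
End SubFun.

Definition unit_ideal (A : comPzRingType) r (f : 'I_r -> A) : Prop :=
  exists c : 'I_r -> A, \sum_i c i * f i = 1.

Definition unit_gen (A B : comPzRingType) (phi : A -> B) (I : A -> Prop) :=
  exists r (a : 'I_r -> A),
    (forall i, I (a i)) /\ unit_ideal (fun i => phi (a i)).

Definition is_localization (k : fieldType) (A B : kAlg k) (f : A)
    (phi : kHom A B) : Prop :=
  (exists b, phi f * b = 1) /\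
  forall (C : kAlg k) (psi : kHom A C), (exists c, psi f * c = 1) ->
    exists! chi : kHom B C, kcomp chi phi = psi.

(* Compatibility is tested on every algebra under both localizations A_{f_i}
   and A_{f_j}, equivalently on their pushout A_{f_i f_j}. *)
Definition zariski_sheaf (k : fieldType) (X : kfun k) : Prop :=
  forall (A : kAlg k) r (f : 'I_r -> A) (B : 'I_r -> kAlg k)
    (phi : forall i, kHom A (B i)),
  unit_ideal f -> (forall i, is_localization (f i) (phi i)) ->
  forall x : forall i, X (B i),
  (forall i j (C : kAlg k) (u : kHom (B i) C) (v : kHom (B j) C),
     kcomp u (phi i) = kcomp v (phi j) -> ptmap u (x i) = ptmap v (x j)) ->
  exists! y : X A, forall i, ptmap (phi i) y = x i.

(* The pullback of an open subfunctor along Spec A -> X is the open subscheme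
   D(I) of Spec A; the pullback of a closed one is the closed subscheme V(I). *)
Definition open_sub (k : fieldType) (X : kfun k) (U : sub X) : Prop :=
  forall (A : kAlg k) (x : X A), exists I : A -> Prop,
  forall (B : kAlg k) (phi : kHom A B), U B (ptmap phi x) <-> unit_gen phi I.

Definition closed_sub (k : fieldType) (X : kfun k) (Z : sub X) : Prop :=
  forall (A : kAlg k) (x : X A), exists I : A -> Prop,
  forall (B : kAlg k) (phi : kHom A B),
    Z B (ptmap phi x) <-> forall a, I a -> phi a = 0.

Section Image.
Variables (k : fieldType) (X : kfun k) (A : kAlg k) (u : X A).
Definition im_pred (B : kAlg k) (x : X B) : Prop :=
  exists phi : kHom A B, ptmap phi u = x.
Lemma im_stable B C (f : kHom B C) (x : X B) :
  im_pred x -> im_pred (ptmap f x).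
Proof. by case=> phi <-; exists (kcomp f phi); rewrite ptmap_comp. Qed.
Definition im : sub X := Sub im_stable.
End Image.

(* u : X A, seen as a morphism Spec A -> X, is an open immersion. *)
Definition chart (k : fieldType) (X : kfun k) (A : kAlg k) (u : X A) : Prop :=
  (forall (B : kAlg k) (phi psi : kHom A B),
     ptmap phi u = ptmap psi u -> phi = psi) /\ open_sub (im u).

(* As usual for functors of points, open subfunctors cover X when they do so
   on K-points for every field K. *)
Definition scheme (k : fieldType) (X : kfun k) : Prop :=
  zariski_sheaf X /\
  forall (K : fieldType) (io : {rmorphism k -> K}) (x : X (KAlg io)),
    exists (A : kAlg k) (u : X A), chart u /\ im u (KAlg io) x.

Definition fg_algebra (k : fieldType) (A : kAlg k) : Prop :=
  exists r (g : 'I_r -> A), forall P : A -> Prop,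
    (forall c, P (kAlg_str A c)) -> (forall i, P (g i)) ->
    (forall a b, P a -> P b -> P (a + b) /\ P (a * b)) -> forall a, P a.

Definition finite_type (k : fieldType) (X : kfun k) : Prop :=
  exists r (A : 'I_r -> kAlg k) (u : forall i, X (A i)),
    (forall i, chart (u i) /\ fg_algebra (A i)) /\
    forall (K : fieldType) (io : {rmorphism k -> K}) (x : X (KAlg io)),
      exists i, im (u i) (KAlg io) x.

Section Diagonal.
Variables (k : fieldType) (X : kfun k).
Definition diag_pred (A : kAlg k) (u : kprod X X A) : Prop := u.1 = u.2.
Lemma diag_stable A B (f : kHom A B) (u : kprod X X A) :
  diag_pred u -> diag_pred (ptmap f u).
Proof. by rewrite /diag_pred /= => ->. Qed.
Definition diagonal : sub (kprod X X) := Sub diag_stable.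
End Diagonal.

Definition separated (k : fieldType) (X : kfun k) := closed_sub (diagonal X).

Definition integral_scheme (k : fieldType) (X : kfun k) : Prop :=
  (exists (A : kAlg k) (u : X A), chart u /\ (1 : A) <> 0) /\
  forall (A : kAlg k) (u : X A), chart u -> (1 : A) <> 0 ->
    forall a b : A, a * b = 0 -> a = 0 \/ b = 0.

Definition variety (k : fieldType) (X : kfun k) : Prop :=
  [/\ scheme X, integral_scheme X, separated X & finite_type X].

(* Infinitesimal lifting; for schemes locally of finite type over k this is
   Grothendieck's definition of smoothness over k. *)
Definition smooth (k : fieldType) (X : kfun k) : Prop :=
  forall (A B : kAlg k) (phi : kHom A B),
    (forall b, exists a, phi a = b) ->
    (forall a a' : A, phi a = 0 -> phi a' = 0 -> a * a' = 0) ->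
    forall y : X B, exists x : X A, ptmap phi x = y.

(* P^N(A) is the set of direct summands of rank 1 of A^(N+1), each of them
   being the row space of an idempotent matrix. *)
Definition line_summand (k : fieldType) (N : nat) (A : kAlg k)
    (P : 'rV[A]_N.+1 -> Prop) : Prop :=
  exists E : 'M[A]_N.+1,
    [/\ (E *m E)%R = E,
        forall v, P v <-> exists w : 'rV[A]_N.+1, v = (w *m E)%R &
        forall (K : fieldType) (io : {rmorphism k -> K})
          (phi : kHom A (KAlg io)),
          \rank (map_mx phi E : 'M[K]_N.+1) = 1%N].

Section ProjectiveSpace.
Variables (k : fieldType) (N : nat).

Definition span_map (A B : kAlg k) (f : kHom A B) (P : 'rV[A]_N.+1 -> Prop)
    (v : 'rV[B]_N.+1) : Prop :=
  exists m (c : 'I_m -> B) (w : 'I_m -> 'rV[A]_N.+1),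
    (forall i, P (w i)) /\ v = \sum_i c i *: map_mx f (w i).

Lemma span_mapE A B (f : kHom A B) (P : 'rV[A]_N.+1 -> Prop) (E : 'M[A]_N.+1) :
  (forall v, P v <-> exists w : 'rV[A]_N.+1, v = (w *m E)%R) ->
  forall v, span_map f P v <-> exists w : 'rV[B]_N.+1, v = (w *m map_mx f E)%R.
Proof.
move=> PE v; split=> [[m [c [w [Pw ->]]]]|[w ->]].
  have /choice[t tE] : forall i, exists t, w i = (t *m E)%R.
    by move=> i; apply/PE.
  exists (\sum_i c i *: map_mx f (t i)); rewrite mulmx_suml.
  by apply: eq_bigr => i _; rewrite tE map_mxM -scalemxAl.
exists N.+1, (fun i => w 0 i), (fun i => row i E); split=> [i|].
  by apply/PE; exists (delta_mx 0 i); rewrite -rowE.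
apply/rowP=> j; rewrite mxE summxE; apply: eq_bigr => i _.
by rewrite !mxE.
Qed.

Lemma span_map_line A B (f : kHom A B) (P : 'rV[A]_N.+1 -> Prop) :
  line_summand P -> line_summand (span_map f P).
Proof.
case=> E [EE PE rkE]; exists (map_mx f E); split.
- by rewrite -map_mxM EE.
- exact: span_mapE.
- move=> K io phi; rewrite -map_mx_comp; exact: (rkE K io (kcomp phi f)).
Qed.

Definition pspace_pt (A : kAlg k) :=
  {P : 'rV[A]_N.+1 -> Prop | line_summand P}.
Definition pspace_map A B (f : kHom A B) (P : pspace_pt A) : pspace_pt B :=
  exist _ (span_map f (sval P)) (span_map_line f (svalP P)).

Lemma pspace_eq A (P Q : pspace_pt A) :
  (forall v, sval P v <-> sval Q v) -> P = Q.
Proof.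
case: P Q => P LP [Q LQ] /= PQ.
have e : P = Q by apply: funext => v; apply: propext.
by case: _ / e LQ {PQ} => LQ; congr exist; apply: Prop_irrelevance.
Qed.

Lemma pspace_id A (P : pspace_pt A) : pspace_map (kid A) P = P.
Proof.
apply: pspace_eq => v; case: P => P [E [EE PE rkE]] /=.
rewrite (span_mapE (kid A) PE) PE.
by have -> : map_mx (kid A) E = E by apply/matrixP=> i j; rewrite mxE.
Qed.

Lemma pspace_comp A B C (g : kHom B C) (f : kHom A B) (P : pspace_pt A) :
  pspace_map (kcomp g f) P = pspace_map g (pspace_map f P).
Proof.
apply: pspace_eq => v; case: P => P [E [EE PE rkE]] /=.
rewrite (span_mapE (kcomp g f) PE) (span_mapE g (span_mapE f PE)).
by rewrite -map_mx_comp.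
Qed.

Definition pspace : kfun k := KFun pspace_id pspace_comp.
End ProjectiveSpace.

(* X is isomorphic to a locally closed subscheme of some P^N. *)
Definition quasi_projective (k : fieldType) (X : kfun k) : Prop :=
  exists N (f : kmor X (pspace k N)) (Z U : sub (pspace k N)),
    [/\ closed_sub Z, open_sub U,
        forall A, injective (f A) &
        forall A (y : pspace k N A), (exists x, f A x = y) <-> Z A y /\ U A y].

(* A module over the structure sheaf of X, given by an A-module for every
   A-point of X; restriction maps carry a proof that the target point is the
   image of the source point, to avoid transport along ptmap_id and ptmap_comp. *)
Record omod (k : fieldType) (X : kfun k) := OMod {
  msec :> forall A : kAlg k, X A -> lmodType A;
  mres : forall A B (f : kHom A B) (x : X A) (y : X B),
    ptmap f x = y -> msec x -> msec y;
  mresD : forall A B (f : kHom A B) (x : X A) (y : X B) (e : ptmap f x = y) m m',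
    mres e (m + m') = mres e m + mres e m';
  mresZ : forall A B (f : kHom A B) (x : X A) (y : X B) (e : ptmap f x = y) a m,
    mres e (a *: m) = f a *: mres e m;
  mres_id : forall A (x : X A) (e : ptmap (kid A) x = x) m, mres e m = m;
  mres_comp : forall A B C (f : kHom A B) (g : kHom B C) (x : X A) (y : X B)
    (z : X C) (e : ptmap f x = y) (e' : ptmap g y = z)
    (e'' : ptmap (kcomp g f) x = z) m,
    mres e'' m = mres e' (mres e m) }.
Arguments msec {k X} o {A} x.
Arguments mres {k X} o {A B f x y} _ _.

Lemma mres_eq (k : fieldType) (X : kfun k) (M : omod X) A B (f g : kHom A B)
    (x : X A) (y : X B) (e : ptmap f x = y) (e' : ptmap g x = y) m :
  f = g -> mres M e m = mres M e' m.
Proof. by move=> fg; case: _ / fg e' => e'; rewrite (Prop_irrelevance e e'). Qed.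

Lemma mres0 (k : fieldType) (X : kfun k) (M : omod X) A B (f : kHom A B)
    (x : X A) (y : X B) (e : ptmap f x = y) : mres M e 0 = 0.
Proof. by rewrite -(scale0r 0) mresZ rmorph0 scale0r. Qed.

Record section (k : fieldType) (X : kfun k) (M : omod X) := Section_ {
  sec_val :> forall A (x : X A), M A x;
  sec_res : forall A B (f : kHom A B) (x : X A) (y : X B) (e : ptmap f x = y),
    mres M e (sec_val x) = sec_val y }.
Arguments sec_val {k X M} s {A} x.

Section StructureSheaf.
Variables (k : fieldType) (X : kfun k).
Definition Osec (A : kAlg k) (x : X A) : lmodType A := A^o.
Definition Ores A B (f : kHom A B) (x : X A) (y : X B) (e : ptmap f x = y)
  (a : Osec x) : Osec y := f a.
Lemma OresD A B (f : kHom A B) (x : X A) (y : X B) (e : ptmap f x = y) m m' :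
  Ores e (m + m') = Ores e m + Ores e m'.
Proof. exact: rmorphD. Qed.
Lemma OresZ A B (f : kHom A B) (x : X A) (y : X B) (e : ptmap f x = y) a m :
  Ores e (a *: m) = f a *: Ores e m.
Proof. exact: rmorphM. Qed.
Definition Omod : omod X := @OMod k X Osec Ores OresD OresZ
  (fun A x e m => erefl) (fun A B C f g x y z e e' e'' m => erefl).
End StructureSheaf.

Section Pullback.
Variables (k : fieldType) (X Y : kfun k) (q : kmor X Y).
Lemma pull_pt A B (f : kHom A B) (x : X A) (y : X B) :
  ptmap f x = y -> ptmap f (q A x) = q B y.
Proof. by move=> <-; rewrite mor_nat. Qed.

Definition pull (M : omod Y) : omod X := @OMod k X
  (fun A x => M A (q A x)) (fun A B f x y e => mres M (pull_pt e))
  (fun A B f x y e => mresD (pull_pt e)) (fun A B f x y e => mresZ (pull_pt e))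
  (fun A x e => mres_id (pull_pt e))
  (fun A B C f g x y z e e' e'' =>
     mres_comp (pull_pt e) (pull_pt e') (pull_pt e'')).

Definition pull_section (M : omod Y) (s : section M) : section (pull M) :=
  @Section_ k X (pull M) (fun A x => sec_val s (q A x))
    (fun A B f x y e => sec_res s (pull_pt e)).
End Pullback.

(* b maps to a basis of the localized module M[1/f] over A[1/f]. *)
Definition basis_away (A : comPzRingType) (M : lmodType A) (f : A) n
    (b : 'I_n -> M) : Prop :=
  (forall m, exists N (c : 'I_n -> A), f ^+ N *: m = \sum_i c i *: b i) /\
  (forall c : 'I_n -> A, \sum_i c i *: b i = 0 ->
     exists N, forall i, f ^+ N * c i = 0).

(* Vector bundle of rank n: Zariski-locally on every Spec A -> X the module
   has n sections that form a basis, also after every base change A -> B.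
   Stability under base change encodes quasi-coherence, i.e. that
   M_x \otimes_A B -> M_y is an isomorphism. *)
Definition vector_bundle (k : fieldType) (X : kfun k) (n : nat) (M : omod X) :
    Prop :=
  forall (A : kAlg k) (x : X A), exists r (f : 'I_r -> A), unit_ideal f /\
  forall i, exists b : 'I_n -> M A x,
    forall (B : kAlg k) (phi : kHom A B) (y : X B) (e : ptmap phi x = y),
      basis_away (phi (f i)) (fun j => mres M e (b j)).

Definition line_bundle (k : fieldType) (X : kfun k) (L : omod X) : Prop :=
  vector_bundle 1 L.

(* T -> X factors through the zero scheme of s iff s pulls back to 0 on T. *)
Section ZeroLocus.
Variables (k : fieldType) (X : kfun k) (M : omod X) (s : section M).
Definition zero_pred (A : kAlg k) (x : X A) : Prop := sec_val s x = 0.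
Lemma zero_stable A B (f : kHom A B) (x : X A) :
  zero_pred x -> zero_pred (ptmap f x).
Proof.
by rewrite /zero_pred -(sec_res s (erefl (ptmap f x))) => ->; rewrite mres0.
Qed.
Definition zero_locus : sub X := Sub zero_stable.
End ZeroLocus.

Definition restr (k : fieldType) (A B : kAlg k) (rho : kHom A B)
  (M : lmodType B) : Type := M.

Section Restriction.
Variables (k : fieldType) (A B : kAlg k) (rho : kHom A B) (M : lmodType B).
HB.instance Definition _ := GRing.Zmodule.on (restr rho M).
Definition restr_scale (a : A) (m : restr rho M) : restr rho M :=
  rho a *: (m : M).
Lemma restr_scaleA a b m :
  restr_scale a (restr_scale b m) = restr_scale (a * b) m.
Proof. by rewrite /restr_scale scalerA rmorphM. Qed.
Lemma restr_scale1 : left_id 1 restr_scale.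
Proof. by move=> m; rewrite /restr_scale rmorph1 scale1r. Qed.
Lemma restr_scaleDr : right_distributive restr_scale +%R.
Proof. by move=> a m m'; rewrite /restr_scale scalerDr. Qed.
Lemma restr_scaleDl m : {morph restr_scale^~ m : a b / a + b}.
Proof. by move=> a b; rewrite /restr_scale rmorphD scalerDl. Qed.
HB.instance Definition _ := GRing.Zmodule_isLmodule.Build A (restr rho M)
  restr_scaleA restr_scale1 restr_scaleDr restr_scaleDl.
End Restriction.

(* Spec A x_H Z, for h : Spec A -> H, is the affine scheme Spec fib_alg. *)
Record affine_fibre (k : fieldType) (Z H : kfun k) (p : kmor Z H)
    (A : kAlg k) (h : H A) := AffineFibre {
  fib_alg : kAlg k;
  fib_str : kHom A fib_alg;
  fib_pt : Z fib_alg;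
  fib_over : p _ fib_pt = ptmap fib_str h;
  fib_univ : forall (C : kAlg k) (psi : kHom A C) (w : Z C),
    p _ w = ptmap psi h ->
    exists! chi : kHom fib_alg C,
      kcomp chi fib_str = psi /\ ptmap chi fib_pt = w }.

Definition affine_mor (k : fieldType) (Z H : kfun k) (p : kmor Z H) : Prop :=
  forall (A : kAlg k) (h : H A), exists F : affine_fibre p h, True.

Section Pushforward.
Variables (k : fieldType) (Z H : kfun k) (p : kmor Z H) (Hp : affine_mor p).

Definition fib (A : kAlg k) (h : H A) : affine_fibre p h := sval (cid (Hp h)).

Lemma fib_map_ex A B (f : kHom A B) (h : H A) (h' : H B) : ptmap f h = h' ->
  exists chi : kHom (fib_alg (fib h)) (fib_alg (fib h')),
    kcomp chi (fib_str (fib h)) = kcomp (fib_str (fib h')) f /\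
    ptmap chi (fib_pt (fib h)) = fib_pt (fib h').
Proof.
move=> e; have e' : p _ (fib_pt (fib h')) = ptmap (kcomp (fib_str (fib h')) f) h.
  by rewrite fib_over ptmap_comp e.
by have [chi [? _]] := fib_univ (fib h) e'; exists chi.
Qed.
Definition fib_map A B (f : kHom A B) (h : H A) (h' : H B) (e : ptmap f h = h') :=
  sval (cid (fib_map_ex e)).
Lemma fib_map_str A B (f : kHom A B) (h : H A) (h' : H B) (e : ptmap f h = h') :
  kcomp (fib_map e) (fib_str (fib h)) = kcomp (fib_str (fib h')) f.
Proof. by rewrite /fib_map; case: cid => ? []. Qed.
Lemma fib_map_pt A B (f : kHom A B) (h : H A) (h' : H B) (e : ptmap f h = h') :
  ptmap (fib_map e) (fib_pt (fib h)) = fib_pt (fib h').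
Proof. by rewrite /fib_map; case: cid => ? []. Qed.

Lemma fib_map_uniq A B (f : kHom A B) (h : H A) (h' : H B) (e : ptmap f h = h')
    (chi : kHom (fib_alg (fib h)) (fib_alg (fib h'))) :
  kcomp chi (fib_str (fib h)) = kcomp (fib_str (fib h')) f ->
  ptmap chi (fib_pt (fib h)) = fib_pt (fib h') -> fib_map e = chi.
Proof.
move=> c1 c2.
have e' : p _ (fib_pt (fib h')) = ptmap (kcomp (fib_str (fib h')) f) h.
  by rewrite fib_over ptmap_comp e.
have [chi0 [_ u]] := fib_univ (fib h) e'.
by rewrite -(u chi) // -(u (fib_map e)) //; split;
  rewrite ?fib_map_str ?fib_map_pt.
Qed.

(* The A-module (p_* M)(h) is M evaluated at the tautological point
   Spec fib_alg -> Z, i.e. the sections of M on the affine fibre over h. *)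
Variable M : omod Z.
Definition push_sec (A : kAlg k) (h : H A) : lmodType A :=
  restr (fib_str (fib h)) (M _ (fib_pt (fib h))).
Definition push_res A B (f : kHom A B) (h : H A) (h' : H B)
  (e : ptmap f h = h') (m : push_sec h) : push_sec h' :=
  mres M (fib_map_pt e) m.

Lemma push_resD A B (f : kHom A B) (h : H A) (h' : H B) (e : ptmap f h = h')
  m m' : push_res e (m + m') = push_res e m + push_res e m'.
Proof. exact: mresD. Qed.

Lemma push_resZ A B (f : kHom A B) (h : H A) (h' : H B) (e : ptmap f h = h')
  a m : push_res e (a *: m) = f a *: push_res e m.
Proof.
rewrite /push_res [LHS]mresZ.
by have /(congr1 (fun g : kHom _ _ => g a)) /= -> := fib_map_str e.
Qed.

Lemma push_res_id A (h : H A) (e : ptmap (kid A) h = h) m : push_res e m = m.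
Proof.
have E : fib_map e = kid _.
  by apply: fib_map_uniq; [apply: kHom_eq | rewrite ptmap_id].
by rewrite /push_res (mres_eq (fib_map_pt e) (ptmap_id _) m E) mres_id.
Qed.

Lemma push_res_comp A B C (f : kHom A B) (g : kHom B C) (x : H A) (y : H B)
    (z : H C) (e : ptmap f x = y) (e' : ptmap g y = z)
    (e'' : ptmap (kcomp g f) x = z) m :
  push_res e'' m = push_res e' (push_res e m).
Proof.
have E : fib_map e'' = kcomp (fib_map e') (fib_map e).
  apply: fib_map_uniq; last by rewrite ptmap_comp !fib_map_pt.
  by rewrite spec_comp fib_map_str -spec_comp fib_map_str spec_comp.
have e3 : ptmap (kcomp (fib_map e') (fib_map e)) (fib_pt (fib x)) =
          fib_pt (fib z) by rewrite ptmap_comp !fib_map_pt.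
rewrite /push_res (mres_eq (fib_map_pt e'') e3 m E).
exact: mres_comp.
Qed.

Definition push : omod H :=
  @OMod k H push_sec push_res push_resD push_resZ push_res_id push_res_comp.

Definition push_section (s : section M) : section push :=
  @Section_ k H push (fun A h => sec_val s (fib_pt (fib h)))
    (fun A B f h h' e => sec_res s (fib_map_pt e)).
End Pushforward.

Section Divisors.
Variables (k : fieldType) (X : kfun k) (D : sub X).

(* The closed subscheme D is locally the zero scheme of a nonzerodivisor. *)
Definition effective_divisor : Prop :=
  closed_sub D /\
  forall (K : fieldType) (io : {rmorphism k -> K}) (x : X (KAlg io)),
  exists (A : kAlg k) (u : X A), [/\ chart u, im u (KAlg io) x &
    exists g : A, (forall a, g * a = 0 -> a = 0) /\
      forall (B : kAlg k) (phi : kHom A B), D B (ptmap phi u) <-> phi g = 0].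

Definition ideal_of (A : kAlg k) (u : X A) (a : A) : Prop :=
  forall (B : kAlg k) (phi : kHom A B), D B (ptmap phi u) -> phi a = 0.

(* L is isomorphic to O_X(D) = Hom(I_D, O_X): on every affine open chart
   u : Spec A -> X, the map th identifies L(u) with Hom_A(I_D(u), A), compatibly
   with restriction.  Values of th outside of charts and of I_D(u) are junk. *)
Definition is_O_of_divisor (L : omod X) : Prop :=
  exists th : forall (A : kAlg k) (u : X A), L A u -> A -> A,
  forall (A : kAlg k) (u : X A), chart u ->
  [/\ forall m (c a b : A), ideal_of u a -> ideal_of u b ->
        th A u m (c * a + b) = c * th A u m a + th A u m b,
      forall m m' (c a : A), ideal_of u a ->
        th A u (c *: m + m') a = c * th A u m a + th A u m' a,
      forall m m', (forall a, ideal_of u a -> th A u m a = th A u m' a) ->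
        m = m',
      forall g : A -> A,
        (forall c a b : A, ideal_of u a -> ideal_of u b ->
           g (c * a + b) = c * g a + g b) ->
        exists m, forall a, ideal_of u a -> th A u m a = g a &
      forall (B : kAlg k) (v : X B) (f : kHom A B) (e : ptmap f u = v),
        chart v -> forall m a, ideal_of u a ->
        th B v (mres L e m) (f a) = f (th A u m a)].

Definition defines (L : omod X) (s : section L) : Prop :=
  forall (A : kAlg k) (x : X A), zero_locus s A x <-> D A x.
End Divisors.

Section Projections.
Variables (k : fieldType) (T Y : kfun k) (W : sub (kprod T Y)).
Definition pr1 : kmor (sfun W) T :=
  @KMor k (sfun W) T (fun A w => (sval w).1) (fun A B f w => erefl).
Definition pr2 : kmor (sfun W) Y :=
  @KMor k (sfun W) Y (fun A w => (sval w).2) (fun A B f w => erefl).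
End Projections.

(* p is affine and p_* O_Z is a vector bundle of rank n, that is, p is finite
   flat (locally free) of degree n. *)
Definition finite_flat (k : fieldType) (n : nat) (Z H : kfun k)
    (p : kmor Z H) : Prop :=
  exists Hp : affine_mor p, vector_bundle n (push Hp (Omod Z)).

(* A closed subscheme W of T x Y, finite and locally free of degree n over T. *)
Definition family (k : fieldType) (n : nat) (T Y : kfun k)
    (W : sub (kprod T Y)) : Prop :=
  closed_sub W /\ finite_flat n (pr1 W).

(* H, with universal subscheme W, is the Hilbert scheme of n points on Y: it
   represents A |-> { families of length n subschemes of Y over Spec A }. *)
Record is_hilbert (k : fieldType) (n : nat) (Y H : kfun k)
    (W : sub (kprod H Y)) : Prop := IsHilbert {
  hilb_scheme : scheme H;
  hilb_family : family n W;
  hilb_univ : forall (A : kAlg k) (V : sub (kprod (Spec A) Y)), family n V ->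
    exists! h : H A, forall (B : kAlg k) (phi : kHom A B) (y : Y B),
      V B (phi, y) <-> W B (ptmap phi h, y) }.

Section Tautological.
Variables (k : fieldType) (n : nat) (X H : kfun k) (Z : sub (kprod H X)).
Hypothesis hilb : is_hilbert n Z.

Lemma hilb_affine : affine_mor (pr1 Z).
Proof. by case: (hilb_family hilb) => _ []. Qed.

Definition taut (L : omod X) : omod H := push hilb_affine (pull (pr2 Z) L).
Definition taut_section (L : omod X) (s : section L) : section (taut L) :=
  push_section hilb_affine (pull_section (pr2 Z) s).
End Tautological.

(* Main.v *)
(** Modulo a maximal ideal of A with residue field K, a finite free A-algebra B
    becomes finite-dimensional over K, hence zero-dimensional; its idempotents
    glue local generators of a line bundle on B into one generator.  A lift m of
    it generates the bundle wherever a certain element w of B is invertible, and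
    w divides the determinant of multiplication by w, which is an element of A
    that is nonzero in K.  These determinants generate the unit ideal of A, and
    where they are invertible, m times a basis of B is a basis of the bundle: so
    L^[n] is locally free of rank n.

    A family over Spec A lies in the zero locus of the tautological section iff s
    vanishes on the universal point of the family, that is, iff the family lies
    in D.  Hence the zero locus and Hilb^n(D) represent the same functor. *)
Require Import Defs.
From HB Require Import structures.
From mathcomp Require Import all_boot all_order all_algebra ring_quotient ring.
From mathcomp Require Import boolp classical_sets reals complex.

Set Implicit Arguments.
Unset Strict Implicit.
Unset Printing Implicit Defensive.

Import GRing.Theory.
Local Open Scope ring_scope.

(** * Quotients and residue fields *)

Definition is_ideal (A : comPzRingType) (I : A -> Prop) : Prop :=
  I 0 /\ forall a u v, I u -> I v -> I (a * u + v).

(** [I] may be all of [A], in which case [Q] is the zero ring. The additive quotient is formed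
    first; the product is then put on it through chosen representatives. *)
Lemma quotient_ring (A : comPzRingType) (I : A -> Prop) : is_ideal I ->
  exists (Q : comPzRingType) (pi : {rmorphism A -> Q}),
    (forall x, exists a, pi a = x) /\ forall a, pi a = 0 <-> I a.
Proof.
case=> I0 IaD.
pose S : {pred A} := fun a => `[< I a >].
have SE x : x \in S <-> I x by split=> /asboolP.
have SZ : zmod_closed S.
  split=> [|u v]; first exact/SE.
  move=> /SE Iu /SE Iv; apply/SE.
  have -> : u - v = -1 * v + u by rewrite mulN1r addrC.
  exact: IaD.
have SM a u : u \in S -> a * u \in S.
  by move=> /SE Iu; apply/SE; rewrite -[_ * _]addr0; apply: IaD.
pose Sz := HB.pack_for (zmodClosed A) S (GRing.isZmodClosed.Build A S SZ).
pose Q := Quotient.quot Sz.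
pose pi : A -> Q := \pi_Q%qT.
have pi_eq x y : (pi x = pi y) <-> (x - y \in S).
  by split=> [/eqP|xy]; [|apply/eqP]; rewrite -Quotient.idealrBE.
have piB x y : pi (x - y) = pi x - pi y by rewrite /pi !piE.
have pirep x : pi (repr x) = x by rewrite /pi reprK.
pose mul (x y : Q) : Q := pi (repr x * repr y).
have piM x y : pi (x * y) = mul (pi x) (pi y).
  apply/pi_eq; set x' := repr _; set y' := repr _.
  have -> : x * y - x' * y' = y * (x - x') + x' * (y - y').
    by rewrite !mulrBr [y * x]mulrC [y * x']mulrC addrA subrK.
  have Sx : x - x' \in S by apply/pi_eq; rewrite pirep.
  have Sy : y - y' \in S by apply/pi_eq; rewrite pirep.
  exact: (@rpredD _ Sz _ _ (SM _ _ Sx) (SM _ _ Sy)).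
have ex x : exists a, pi a = x by exists (repr x).
have mulA : associative mul.
  move=> x y z; have [[[a <-] [b <-]] [c <-]] := (ex x, ex y, ex z).
  by rewrite -!piM mulrA.
have mulC : commutative mul.
  by move=> x y; have [[a <-] [b <-]] := (ex x, ex y); rewrite -!piM mulrC.
have mul1 : left_id (pi 1) mul.
  by move=> x; have [a <-] := ex x; rewrite -!piM mul1r.
have piD x y : pi (x + y) = pi x + pi y by rewrite /pi !piE.
have mulD : left_distributive mul +%R.
  move=> x y z; have [[[a <-] [b <-]] [c <-]] := (ex x, ex y, ex z).
  by rewrite -piD -!piM -piD mulrDl.
pose R := HB.pack_for comPzRingType Q
  (GRing.Zmodule_isComPzRing.Build Q mulA mulC mul1 mulD).
pose piR : A -> R := pi.
have piRB : zmod_morphism piR by exact: piB.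
have piRM : monoid_morphism piR by split.
pose pim := HB.pack_for {rmorphism A -> R} piR
   (GRing.isZmodMorphism.Build A R piR piRB)
   (GRing.isMonoidMorphism.Build A R piR piRM).
exists R, pim; split=> [x|a]; first exact: ex.
have -> : I a <-> a - 0 \in S by rewrite subr0 SE.
have pi0 : pi 0 = 0 by rewrite -[X in pi X](subrr 0) piB subrr.
by rewrite -pi_eq pi0.
Qed.

Lemma maximal_ideal (A : comPzRingType) (I : A -> Prop) :
  is_ideal I -> ~ I 1 ->
  exists M : A -> Prop, [/\ is_ideal M, forall a, I a -> M a, ~ M 1 &
    forall a, ~ M a -> exists b, M (b * a - 1)].
Proof.
case=> I0 ID I1.
(* The first clause is vacuous for the empty set, so that P holds for the union
   of the empty chain; it makes every nonempty S contain I. *)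
pose P (S : set A) := [/\ forall a, S a -> forall b, I b -> S b,
  forall a u v, S u -> S v -> S (a * u + v) & ~ S 1].
have [|M [[MI MD M1] Mmax]] := @Zorn_bigcup A P.
  move=> F FP Ftot; split=> [a [S FS Sa] b Ib|a u v [S FS Su] [T FT Tv]|[S FS S1]].
  - by exists S => //; have [SI _ _] := FP _ FS; exact: SI Sa _ Ib.
  - have [ST|TS] := Ftot _ _ FS FT.
      exists T => //; have [_ TD _] := FP _ FT; apply: TD => //; exact: ST.
    exists S => //; have [_ SD _] := FP _ FS; apply: SD => //; exact: TS.
  - by have [_ _] := FP _ FS.
have IP : P I by split=> // a _ b.
have M0 : M 0.
  apply: contrapT => M0; apply: (Mmax I) => //; split.
    by move=> a Ma; case: M0; apply: MI Ma _ I0.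
  by move=> /(_ _ I0).
have {}MI a : I a -> M a by exact: MI M0 a.
exists M; split=> // a Ma; apply: contrapT => nb.
(* [T] is the ideal [M + A a]. It is strictly larger than [M], and it can contain 1 only if [a] is
   invertible modulo [M]. *)
pose T : set A := fun x => exists2 b, M (x - b * a) & True.
have Tsub x : M x -> T x by exists 0 => //; rewrite mul0r subr0.
apply: (Mmax T); last split.
- split=> [|/(_ a) Ta]; first exact: Tsub.
  by apply: Ma; apply: Ta; exists 1 => //; rewrite mul1r subrr.
- by move=> x _ y /MI; exact: Tsub.
- move=> x u v [b Mb _] [c Mc _]; exists (x * b + c) => //.
  have -> : x * u + v - (x * b + c) * a = x * (u - b * a) + (v - c * a).
    by rewrite mulrDl mulrBr opprD addrACA mulrA.
  exact: MD.
- case=> b Mb _; apply: nb; exists b.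
  have -> : b * a - 1 = -1 * (1 - b * a) + 0 by rewrite mulN1r addr0 opprB.
  exact: MD.
Qed.

Lemma residue_field (A : comPzRingType) (I : A -> Prop) :
  is_ideal I -> ~ I 1 ->
  exists (K : fieldType) (pi : {rmorphism A -> K}),
    (forall x, exists a, pi a = x) /\ forall a, I a -> pi a = 0.
Proof.
move=> II I1; have [M [MI IM M1 Minv]] := maximal_ideal II I1.
have [Q [pi [pi_surj pi0]]] := quotient_ring MI.
have Q1 : (1 : Q) != 0.
  by apply/eqP => Q1; apply: M1; apply/pi0; rewrite rmorph1.
(* The first clause provides the convention [0^-1 = 0] that the field structure demands. *)
have inv_ex (x : Q) : exists y : Q, (x = 0 -> y = 0) /\ (x != 0 -> y * x = 1).
  have [a <-] := pi_surj x; have [->|na] := eqVneq (pi a) 0; first by exists 0.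
  have /Minv[b /pi0] : ~ M a by move/pi0/eqP; apply/negP.
  rewrite rmorphB rmorph1 rmorphM => /eqP; rewrite subr_eq0 => /eqP e.
  by exists (pi b); split=> // a0; rewrite a0 eqxx in na.
have [inv invP] := choice inv_ex.
pose Q' := HB.pack_for comNzRingType (Q : Type)
  (GRing.PzSemiRing_isNonZero.Build Q Q1) (GRing.ComPzRing.class Q).
pose K := HB.pack_for fieldType (Q : Type) (GRing.ComNzRing.class Q')
  (GRing.ComNzRing_isField.Build Q' (fun x => (invP x).2) ((invP 0).1 erefl)).
exists K, pi; split=> // a Ia; exact/pi0/IM.
Qed.

(** * Unit ideals and zero-dimensional rings *)

(** If the ideal generated by [G] were proper, it would die in some residue field, where by
    assumption an element of [G] survives. This reduces Zariski-local existence to one residue field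
    at a time. *)
Lemma unit_ideal_gen (A : comPzRingType) (G : A -> Prop) :
  (forall (K : fieldType) (pi : {rmorphism A -> K}),
     (forall x, exists a, pi a = x) -> exists2 g, G g & pi g != 0) ->
  exists r (f : 'I_r -> A), unit_ideal f /\ forall i, G (f i).
Proof.
move=> GK.
pose I a := exists2 s : seq (A * A), (forall p, p \in s -> G p.2) &
  a = \sum_(p <- s) p.1 * p.2.
have I_ideal : is_ideal I.
  split=> [|a u v [s sG ->] [t tG ->]]; first by exists [::]; rewrite ?big_nil.
  exists ([seq (a * p.1, p.2) | p <- s] ++ t) => [p|].
    by rewrite mem_cat => /orP[/mapP[q qs ->]|/tG]; first exact: sG qs.
  rewrite big_cat big_map /= mulr_sumr; congr (_ + _).
  by apply: eq_bigr => p _; rewrite mulrA.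
have [s sG s1] : I 1.
  apply: contrapT => /(residue_field I_ideal)[K [pi [pi_surj pi0]]].
  have [g Gg /eqP[]] := GK K pi pi_surj; apply: pi0.
  by exists [:: (1, g)] => [p|]; rewrite ?big_seq1 ?mul1r // inE => /eqP->.
exists (size s), (fun i => (nth 0 s i).2); split=> [|i]; last by apply/sG/mem_nth.
by exists (fun i => (nth 0 s i).1); rewrite s1 (big_nth 0) big_mkord.
Qed.

(** In a residue field killing [I], every [f i] would be nilpotent, hence zero, although the [f i]
    generate 1. Local statements are glued by letting [I] be the ideal of those [a] for which the
    statement multiplied by [a] holds. *)
Lemma unit_ideal_forall (A : comPzRingType) (I : A -> Prop) r (f : 'I_r -> A) :
  is_ideal I -> unit_ideal f -> (forall i, exists N, I (f i ^+ N)) -> I 1.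
Proof.
move=> I_ideal [c c1] If; apply: contrapT => /(residue_field I_ideal).
case=> K [pi [_ pi0]]; case/eqP: (oner_neq0 K); rewrite -(rmorph1 pi) -c1.
rewrite rmorph_sum big1 // => i _; have [N /pi0] := If i.
by rewrite rmorphXn rmorphM => /eqP /[!expf_eq0] /andP[_ /eqP ->]; rewrite mulr0.
Qed.

Lemma unit_ideal_eq0 (A : comPzRingType) (M : lmodType A) r (f : 'I_r -> A)
    (m : M) :
  unit_ideal f -> (forall i, exists N, f i ^+ N *: m = 0) -> m = 0.
Proof.
move=> f1 fm; rewrite -[m]scale1r.
apply: (unit_ideal_forall (I := fun a => a *: m = 0) _ f1 fm).
split=> [|a u v um vm]; first exact: scale0r.
by rewrite scalerDl -scalerA um vm scaler0 addr0.
Qed.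

Lemma unit_ideal_exp (A : comPzRingType) r (f : 'I_r -> A) N :
  unit_ideal f -> unit_ideal (fun i => f i ^+ N).
Proof.
move=> f1; suff [c c1] : exists c : 'I_r -> A, 1 = \sum_i c i * f i ^+ N by exists c.
apply: (unit_ideal_forall
  (I := fun a => exists c : 'I_r -> A, a = \sum_i c i * f i ^+ N) _ f1).
  split=> [|a u v [c ->] [d ->]].
    by exists (fun=> 0); rewrite big1 // => i _; rewrite mul0r.
  exists (fun i => a * c i + d i); rewrite mulr_sumr -big_split /=.
  by apply: eq_bigr => i _; rewrite mulrDl mulrA.
move=> i; exists N, (fun j => (j == i)%:R).
rewrite (bigD1 i) //= eqxx mul1r big1 ?addr0 // => j /negPf->.
exact: mul0r.
Qed.

Lemma unit_ideal_span (A : comPzRingType) (M : lmodType A) r (f : 'I_r -> A)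
    (m : 'I_r -> M) (x : M) :
  unit_ideal f -> (forall i, exists N c, f i ^+ N *: x = c *: m i) ->
  exists c : 'I_r -> A, x = \sum_i c i *: m i.
Proof.
move=> f1 fx; suff [c cx] : exists c : 'I_r -> A, 1 *: x = \sum_i c i *: m i.
  by exists c; rewrite -cx scale1r.
apply: (unit_ideal_forall
  (I := fun a => exists c : 'I_r -> A, a *: x = \sum_i c i *: m i) _ f1).
  split=> [|a u v [c uE] [d vE]].
    by exists (fun=> 0); rewrite scale0r big1 // => i _; rewrite scale0r.
  exists (fun i => a * c i + d i); rewrite scalerDl -scalerA uE vE scaler_sumr.
  by rewrite -big_split; apply: eq_bigr => i _; rewrite scalerDl scalerA.
move=> i; have [N [c fxi]] := fx i.
exists N, (fun j => if j == i then c else 0); rewrite fxi.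
rewrite (bigD1 i) //= eqxx big1 ?addr0 // => j /negPf->.
exact: scale0r.
Qed.

(** Strong pi-regularity, which for commutative rings says that every prime ideal is maximal. *)
Definition zero_dimensional (B : comPzRingType) : Prop :=
  forall g : B, exists N u, g ^+ N = g ^+ N.+1 * u.

(** The powers [1, g, ..., g ^+ n] satisfy a nontrivial linear relation over [K]. Dividing it by its
    nonzero coefficient of lowest degree [i] exhibits [g ^+ i] as a multiple of [g ^+ i.+1]. *)
Lemma zero_dimensional_finite (K : fieldType) (B : comPzRingType)
    (rho : {rmorphism K -> B}) n (b : 'I_n -> B) :
  (forall x, exists c : 'I_n -> K, x = \sum_i rho (c i) * b i) ->
  zero_dimensional B.
Proof.
move=> b_span g.
have /choice[c cE] : forall i : 'I_n.+1, exists c : 'I_n -> K,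
  g ^+ i = \sum_j rho (c j) * b j by move=> i; exact: b_span.
pose C : 'M[K]_(n.+1, n) := \matrix_(i, j) c i j.
(* [C] has one more row than columns, so its left kernel is nonzero; [v] holds the coefficients of
   the relation. *)
pose v := nz_row (kermx C).
have v0 : v != 0.
  rewrite nz_row_eq0 kermx_eq0 /row_free; apply/eqP => rC.
  by have := rank_leq_col C; rewrite rC ltnn.
have vC : v *m C = 0 by apply/sub_kermxP; exact: nz_row_sub.
have vg : \sum_i rho (v 0 i) * g ^+ i = 0.
  under eq_bigr do rewrite cE mulr_sumr.
  rewrite exchange_big big1 // => j _.
  under eq_bigr do rewrite mulrA -rmorphM.
  rewrite -mulr_suml -rmorph_sum; have /matrixP/(_ 0 j) := vC.
  rewrite !mxE; under eq_bigr do rewrite mxE.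
  by move->; rewrite rmorph0 mul0r.
have [i0 vi0] : exists i, v 0 i != 0.
  by have /rV0Pn := v0.
case: (arg_minnP (P := fun i => v 0 i != 0) (@nat_of_ord n.+1) vi0).
move=> i vi i_min {i0 vi0}.
exists i, (- rho (v 0 i)^-1 *
  \sum_(j < n.+1 | (i < j)%N) rho (v 0 j) * g ^+ (j - i.+1)).
rewrite mulrCA mulr_sumr.
have {vg} : rho (v 0 i) * g ^+ i =
    - \sum_(j < n.+1 | (i < j)%N)
         g ^+ i.+1 * (rho (v 0 j) * g ^+ (j - i.+1)).
  apply/eqP; rewrite -addr_eq0; apply/eqP.
  rewrite -[RHS]vg [RHS](bigD1 i) //=; congr (_ + _).
  rewrite [RHS](bigID (fun j : 'I_n.+1 => (i < j)%N)) /= [X in _ + X]big1 ?addr0.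
    apply: eq_big => [j|j ij]; last by rewrite mulrCA -exprD subnKC.
    by rewrite andb_idl // => ij; apply/eqP => ji; rewrite ji ltnn in ij.
  move=> j /andP[ji]; rewrite -leqNgt => ji'.
  have [->|/i_min ij] := eqVneq (v 0 j) 0; first by rewrite rmorph0 mul0r.
  by case/eqP: ji; apply/val_inj/eqP; rewrite eqn_leq ji'.
move/(congr1 (fun x => rho (v 0 i)^-1 * x)).
by rewrite mulrA -rmorphM mulVf // rmorph1 mul1r => ->; rewrite mulrN mulNr.
Qed.

(** [B] splits as [e B] times [(1 - e) B], with [g] invertible on the first factor and nilpotent on
    the second. The idempotent is a power of [g * u]. *)
Lemma zero_dimensional_idempotent (B : comPzRingType) (g : B) :
  zero_dimensional B ->
  exists e v N, [/\ e * e = e, e = g * v & (1 - e) * g ^+ N = 0].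
Proof.
move=> /(_ g)[N [u gu]].
have gE i : g ^+ N.+1 = g ^+ (N.+1 + i) * u ^+ i.
  elim: i => [|i IH]; first by rewrite addn0 mulr1.
  rewrite IH !exprD exprS [u ^+ i.+1]exprS [g ^+ i.+1]exprS.
  by rewrite {1}gu exprS; ring.
exists (g ^+ N.+1 * u ^+ N.+1), (g ^+ N * u ^+ N.+1), N.+1; split.
- by rewrite mulrACA -exprD mulrA -gE.
- by rewrite exprS mulrA.
- by rewrite mulrBl mul1r mulrAC -exprD -gE subrr.
Qed.

(** Each [o i] is the part of [e i] outside all earlier [e j]; the partial sums of the [o i]
    telescope to one minus the product of the [1 - e j]. *)
Lemma orthogonal_idempotents (B : comPzRingType) r (e : 'I_r -> B) :
  (forall i, e i * e i = e i) -> \prod_i (1 - e i) = 0 ->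
  exists o : 'I_r -> B, [/\ \sum_i o i = 1, forall i, o i * e i = o i &
    forall i j, i != j -> o i * o j = 0].
Proof.
move=> ee e0.
(* Extending [e] by 0 to all natural numbers lets products and inductions run over initial
   segments. *)
pose e' i := if insub i is Some j then e j else 0.
have e'E (i : 'I_r) : e' i = e i by rewrite /e' valK.
pose o i := e' i * \prod_(j < i) (1 - e' j).
have sum_o s : \sum_(i < s) o i = 1 - \prod_(i < s) (1 - e' i).
  elim: s => [|s IH]; first by rewrite !big_ord0 subrr.
  by rewrite !big_ord_recr IH /= /o; ring.
have o0 (i j : 'I_r) : (i < j)%N -> o i * o j = 0.
  move=> ij; rewrite /o (bigD1 (Ordinal ij)) //= e'E.
  set x := \prod_(_ < i) _; set y := \prod_(_ < j | _) _.
  rewrite [LHS](_ : _ = (e i - e i * e i) * (x * e' j * y)); last ring.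
  by rewrite ee subrr mul0r.
exists (fun i => o i); split=> [|i|i j].
- by rewrite sum_o; under eq_bigr do rewrite e'E; rewrite e0 subr0.
- by rewrite /o e'E mulrAC ee.
- by rewrite neq_ltn => /orP[/o0//|/o0 oji]; rewrite mulrC.
Qed.

(* With idempotents o i in (a i i), orthogonal and of sum 1, take t := o and let
   y i * a i i = o i: all cross terms vanish. *)
Lemma zero_dimensional_combination (B : comPzRingType) r
    (a : 'I_r -> 'I_r -> B) :
  zero_dimensional B -> unit_ideal (fun i => a i i) ->
  exists y t : 'I_r -> B, \sum_i \sum_j y i * a i j * t j = 1.
Proof.
move=> B0 a1.
have /choice[e eP] : forall i, exists e, exists v N,
    [/\ e * e = e, e = a i i * v & (1 - e) * a i i ^+ N = 0].
  by move=> i; exact: zero_dimensional_idempotent.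
have /choice[v vP] : forall i, exists v, e i = a i i * v.
  by move=> i; have [v [N [_ ? _]]] := eP i; exists v.
have ee i : e i * e i = e i by have [? [? []]] := eP i.
have e0 : \prod_i (1 - e i) = 0.
  apply: (@unit_ideal_eq0 B B^o _ _ _ a1) => i; have [_ [N [_ _ eN]]] := eP i.
  by exists N; rewrite (bigD1 i) //= /GRing.scale /= mulrA [_ * (1 - _)]mulrC eN mul0r.
have [o [o1 oe oo]] := orthogonal_idempotents ee e0.
exists (fun i => o i * v i), o; rewrite -[RHS]o1; apply: eq_bigr => i _.
rewrite (bigD1 i) //= [X in _ + X]big1 ?addr0 => [|j ji].
  rewrite -[o i * v i * _]mulrA [v i * _]mulrC -vP oe.
  rewrite -[RHS]mulr1 -o1 mulr_sumr (bigD1 i) //= big1 ?addr0 // => j.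
  by rewrite eq_sym; exact: oo.
by rewrite mulrC !mulrA oo // !mul0r.
Qed.

(** * Line bundles *)

Lemma unit_ideal_map (A B : comPzRingType) (phi : {rmorphism A -> B}) r
    (f : 'I_r -> A) :
  unit_ideal f -> unit_ideal (fun i => phi (f i)).
Proof.
case=> c c1; exists (fun i => phi (c i)).
by under eq_bigr do rewrite -rmorphM; rewrite -rmorph_sum c1 rmorph1.
Qed.

Lemma mres_sum (k : fieldType) (X : kfun k) (M : omod X) A B (f : kHom A B)
    (x : X A) (y : X B) (e : ptmap f x = y) r (m : 'I_r -> M A x) :
  mres M e (\sum_i m i) = \sum_i mres M e (m i).
Proof. exact: (big_morph _ (mresD e) (mres0 M e)). Qed.

(* If g i *: m j = a i j *: m i, multiplying by a high power of g i makes the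
   relations between the m j exact. *)
Lemma line_bundle_coordinates (k : fieldType) (X : kfun k) (L : omod X)
    (B : kAlg k) (q : X B) : line_bundle L ->
  exists r (m : 'I_r -> L B q) (a : 'I_r -> 'I_r -> B),
  [/\ unit_ideal (fun i => a i i),
      forall i j l, a i l *: m j = a i j *: m l &
      forall (C : kAlg k) (psi : kHom B C) (p : X C) (e : ptmap psi q = p),
        (forall x, exists c, x = \sum_i c i *: mres L e (m i)) /\
        forall c, (forall i, c *: mres L e (m i) = 0) -> c = 0].
Proof.
move=> /(_ B q)[r [g [g1 /choice[b bP]]]].
pose m i := b i ord0.
have span i (C : kAlg k) (psi : kHom B C) p (e : ptmap psi q = p) (x : L C p) :
    exists N c, psi (g i) ^+ N *: x = c *: mres L e (m i).
  have [/(_ x)[N [c cE]] _] := bP i C psi p e.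
  by exists N, (c ord0); rewrite cE big_ord1.
have free i (C : kAlg k) (psi : kHom B C) p (e : ptmap psi q = p) (c : C) :
    c *: mres L e (m i) = 0 -> exists N, psi (g i) ^+ N * c = 0.
  have [_ /(_ (fun=> c))] := bP i C psi p e.
  by rewrite big_ord1 => + c0 => /(_ c0)[N NP]; exists N; exact: NP ord0.
have /choice[N0 N0P] : forall ij : 'I_r * 'I_r, exists N c,
    g ij.1 ^+ N *: m ij.2 = c *: m ij.1.
  move=> [i j] /=; have [N [c]] := span i B (kid B) q (ptmap_id q) (m j).
  by rewrite mres_id; exists N, c.
pose N := \sum_ij N0 ij.
(* The coefficients are not unique. On the diagonal the value [g i ^+ N] is imposed, so that the
   elements [a i i] become [g i ^+ (N + N)] and generate the unit ideal. *)
have /choice[a0 a0P] : forall ij : 'I_r * 'I_r, exists c,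
    g ij.1 ^+ N *: m ij.2 = c *: m ij.1 /\ (ij.1 = ij.2 -> c = g ij.1 ^+ N).
  move=> [i j] /=; have [<-|/eqP ij] := eqVneq i j; first by exists (g i ^+ N).
  have [c cE] := N0P (i, j); have NE : (N0 (i, j) <= N)%N.
    by rewrite /N (bigD1 (i, j)) //= leq_addr.
  exists (g i ^+ (N - N0 (i, j)) * c); split=> //.
  by rewrite -scalerA -cE scalerA -exprD subnK.
have a0E i j : g i ^+ N *: m j = a0 (i, j) *: m i by have [] := a0P (i, j).
exists r, m, (fun i j => g i ^+ N * a0 (i, j)); split=> [|i j l|C psi p e].
- have -> : (fun i => g i ^+ N * a0 (i, i)) = fun i => g i ^+ (N + N).
    by apply: funext => i; have [_ ->//] := a0P (i, i); rewrite exprD.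
  exact: unit_ideal_exp.
- rewrite ![_ * a0 _]mulrC -!scalerA !a0E !scalerA; congr (_ *: _).
  exact: mulrC.
split=> [x|c cm].
  by apply: unit_ideal_span (unit_ideal_map psi g1) _ => i; exact: span.
apply: (@unit_ideal_eq0 C C^o _ _ _ (unit_ideal_map psi g1)) => i.
exact: free (cm i).
Qed.

(** Over [C] some combination of the [a i j] with coefficients [y i] and [t j] equals 1. Lifting the
    coefficients to [B] gives [w], together with [m] as the combination of the [m j] with
    coefficients [t j]. The relations between the [m j] make each [w *: m l] a multiple of [m], so
    [m] is a generator wherever [w] is invertible, after any base change. *)
Lemma line_bundle_generator (k : fieldType) (X : kfun k) (L : omod X)
    (B C : kAlg k) (q : X B) (chi : kHom B C) :
  line_bundle L -> zero_dimensional C -> (forall c, exists b, chi b = c) ->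
  exists (w : B) (m : L B q), chi w = 1 /\
    forall (B' : kAlg k) (psi : kHom B B') (p : X B') (e : ptmap psi q = p),
      (forall x, exists c, psi w *: x = c *: mres L e m) /\
      forall c, c *: mres L e m = 0 -> c * psi w = 0.
Proof.
move=> Lline C0 chi_surj.
have [r [m [a [a1 aC mP]]]] := line_bundle_coordinates q Lline.
have [y' [t' yt1]] :=
  zero_dimensional_combination (a := fun i j => chi (a i j)) C0
    (unit_ideal_map chi a1).
have /choice[y yE] := fun i => chi_surj (y' i).
have /choice[t tE] := fun i => chi_surj (t' i).
exists (\sum_i \sum_j y i * a i j * t j), (\sum_j t j *: m j); split.
  rewrite rmorph_sum -yt1; apply: eq_bigr => i _; rewrite rmorph_sum.
  by apply: eq_bigr => j _; rewrite !rmorphM /= yE tE.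
move=> B' psi p e; have [span free] := mP B' psi p e.
pose m' j := mres L e (m j).
have aC' i j l : psi (a i l) *: m' j = psi (a i j) *: m' l.
  by rewrite -!mresZ aC.
have -> : mres L e (\sum_j t j *: m j) = \sum_j psi (t j) *: m' j.
  by rewrite mres_sum; apply: eq_bigr => j _; rewrite mresZ.
have aM i l : psi (a i l) *: (\sum_j psi (t j) *: m' j) =
    (\sum_j psi (a i j) * psi (t j)) *: m' l.
  rewrite scaler_sumr scaler_suml; apply: eq_bigr => j _.
  by rewrite scalerA mulrC -[LHS]scalerA aC' scalerA mulrC.
have -> : psi (\sum_i \sum_j y i * a i j * t j) =
    \sum_i psi (y i) * \sum_j psi (a i j) * psi (t j).
  rewrite rmorph_sum; apply: eq_bigr => i _; rewrite rmorph_sum mulr_sumr.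
  by apply: eq_bigr => j _; rewrite !rmorphM mulrA.
have wM l : (\sum_i psi (y i) * \sum_j psi (a i j) * psi (t j)) *: m' l =
    (\sum_i psi (y i) * psi (a i l)) *: (\sum_j psi (t j) *: m' j).
  transitivity (\sum_i psi (y i) *: ((\sum_j psi (a i j) * psi (t j)) *: m' l)).
    by rewrite scaler_suml; apply: eq_bigr => i _; rewrite scalerA.
  rewrite [RHS]scaler_suml; apply: eq_bigr => i _.
  by rewrite -aM scalerA.
split=> [x|c cm0].
  have [c ->] := span x.
  exists (\sum_l c l * \sum_i psi (y i) * psi (a i l)).
  rewrite scaler_sumr [RHS]scaler_suml; apply: eq_bigr => l _.
  by rewrite scalerA mulrC -[LHS]scalerA wM scalerA.
(* If [c] kills [m], then [c] times each inner sum of [w] kills every [m' l], hence vanishes. *)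
rewrite mulr_sumr big1 // => i _; rewrite mulrCA.
rewrite [X in _ * X](_ : _ = 0) ?mulr0 //; apply: free => l.
by rewrite -scalerA -aM scalerA mulrC -scalerA cm0 scaler0.
Qed.

(** * Pushforward of line bundles *)

(** This is Cramer's rule: [W] represents multiplication by [w] up to a power of [f], and its
    adjugate shows that [\det W] times each [b j] is a multiple of [w]. Only generation by the [b j]
    away from [f] is used, so [W] is a choice. *)
Lemma det_multiple (A B : comPzRingType) (rho : {rmorphism A -> B}) f n
    (b : 'I_n -> B) (w : B) :
  (forall x, exists N (c : 'I_n -> A),
     rho f ^+ N * x = \sum_i rho (c i) * b i) ->
  exists N (W : 'M[A]_n),
    (forall j, rho f ^+ N * (w * b j) = \sum_l rho (W j l) * b l) /\
    exists N' v, rho (f * \det W) ^+ N' = w * v.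
Proof.
move=> span.
have /choice[N0 N0P] : forall j, exists N (c : 'I_n -> A),
  rho f ^+ N * (w * b j) = \sum_l rho (c l) * b l by move=> j; exact: span.
pose N := \sum_j N0 j.
have /choice[c cE] : forall j, exists c : 'I_n -> A,
    rho f ^+ N * (w * b j) = \sum_l rho (c l) * b l.
  move=> j; have [c cE] := N0P j; exists (fun l => f ^+ (N - N0 j) * c l).
  rewrite -(@subnK (N0 j) N); last by rewrite /N (bigD1 j) //= leq_addr.
  rewrite exprD -mulrA cE mulr_sumr; apply: eq_bigr => l _.
  by rewrite addnK rmorphM rmorphXn mulrA.
pose W : 'M[A]_n := \matrix_(j, l) c j l.
have WE j : rho f ^+ N * (w * b j) = \sum_l rho (W j l) * b l.
  by rewrite cE; apply: eq_bigr => l _; rewrite mxE.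
exists N, W; split=> //.
pose v j := rho f ^+ N * \sum_l rho (\adj W j l) * b l.
have detE j : rho (\det W) * b j = w * v j.
  transitivity (\sum_l rho ((\adj W *m W) j l) * b l).
    rewrite mul_adj_mx (bigD1 j) //= big1 ?addr0 => [|l /negPf lj].
      by rewrite mxE eqxx mulr1n.
    by rewrite mxE eq_sym lj mulr0n rmorph0 mul0r.
  under eq_bigr do rewrite mxE rmorph_sum mulr_suml.
  rewrite exchange_big /v !mulr_sumr; apply: eq_bigr => l _ /=.
  transitivity (rho (\adj W j l) * \sum_i rho (W l i) * b i).
    by rewrite mulr_sumr; apply: eq_bigr => i _; rewrite rmorphM mulrA.
  by rewrite -WE; ring.
(* Expanding a power of [f] in the [b j] turns the divisibility of the [\det W * b j] into one for
   [f ^+ N' * \det W]. The exponent [N'.+1] then covers both factors of [f * \det W]. *)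
have [N' [d dE]] := span 1.
exists N'.+1, ((\sum_j rho (d j) * v j) * (rho f * rho (\det W) ^+ N')).
rewrite mulrA mulr_sumr; under eq_bigr do rewrite mulrCA -detE mulrCA.
rewrite -mulr_sumr -dE rmorphM exprMn !exprS; ring.
Qed.

Lemma basis_away_restr (k : fieldType) (A B : kAlg k) (rho : kHom A B)
    (M : lmodType B) f n (b : 'I_n -> M) :
  basis_away (M := restr rho M) f b <->
  (forall m, exists N (c : 'I_n -> A), rho f ^+ N *: m = \sum_i rho (c i) *: b i) /\
  (forall c : 'I_n -> A, \sum_i rho (c i) *: b i = 0 ->
     exists N, forall i, f ^+ N * c i = 0).
Proof.
split=> -[span free]; split=> // m; have [N [c cE]] := span m; exists N, c.
  by rewrite -rmorphXn.
by rewrite -rmorphXn in cE.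
Qed.

(** For each residue field [K] of [A], an element that is nonzero in [K] is needed away from which a
    basis exists. The element is [f i * \det W]: the first factor makes the fibre algebra free on
    the [b j], the second makes [m] a generator, and the basis consists of the [b j *: m]. *)
Lemma push_line_bundle (k : fieldType) (Z H : kfun k) (p : kmor Z H)
    (Hp : affine_mor p) n (M : omod Z) :
  vector_bundle n (push Hp (Omod Z)) -> line_bundle M ->
  vector_bundle n (push Hp M).
Proof.
move=> Ofree Mline A h.
pose good a := exists b : 'I_n -> push Hp M A h,
  forall (B : kAlg k) (phi : kHom A B) (y : H B) (e : ptmap phi h = y),
    basis_away (phi a) (fun j => mres (push Hp M) e (b j)).
suff [r [f [f1 fP]]] : exists r (f : 'I_r -> A), unit_ideal f /\ forall i, good (f i).
  by exists r, f.
apply: unit_ideal_gen => K pi pi_surj.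
pose C : kAlg k := KAlg (pi \o kAlg_str A : {rmorphism k -> K}).
pose phi : kHom A C := @KHom k A C pi (rmorphB pi)
  (conj (rmorph1 pi) (rmorphM pi)) (fun=> erefl).
have [r [f [[u u1] fP]]] := Ofree A h.
have [i fi0] : exists i, pi (f i) != 0.
  apply: contrapT => nf; case/eqP: (oner_neq0 K).
  rewrite -(rmorph1 pi) -u1 rmorph_sum big1 // => i _; rewrite rmorphM.
  by have [->|nfi] := eqVneq (pi (f i)) 0; rewrite ?mulr0 //; case: nf; exists i.
have {u u1 fP} [b bP] := fP i.
pose F (A' : kAlg k) (y : H A') := fib Hp y.
have {}bP (A' : kAlg k) (psi : kHom A A') y (e : ptmap psi h = y) :
  (forall x, exists N (c : 'I_n -> A'), fib_str (F _ y) (psi (f i)) ^+ N * x =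
     \sum_j fib_str (F _ y) (c j) * fib_map Hp e (b j)) /\
  (forall c : 'I_n -> A',
     \sum_j fib_str (F _ y) (c j) * fib_map Hp e (b j) = 0 ->
     exists N, forall j, psi (f i) ^+ N * c j = 0).
  by have [] := (basis_away_restr (fib_str (F _ y)) _ _).1 (bP A' psi y e).
pose rho := fib_str (F _ h).
have span x : exists N (c : 'I_n -> A), rho (f i) ^+ N * x =
    \sum_j rho (c j) * b j.
  have [/(_ x)[N [c cE]] _] := bP A (kid A) h (ptmap_id h).
  exists N, c; rewrite cE; apply: eq_bigr => j _; congr (_ * _).
  exact: (push_res_id (M := Omod Z) (ptmap_id h)).
pose h' := ptmap phi h; pose chi := fib_map Hp (erefl h').
pose sigma := fib_str (F _ h').
have chiE a : chi (rho a) = sigma (pi a).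
  by have /(congr1 (fun g : kHom _ _ => g a)) := fib_map_str Hp (erefl h').
(* Since [f i] is invertible in [K], the images [chi (b j)] form a true [K]-basis of the fibre
   algebra. Hence that algebra is zero-dimensional and [chi] is surjective. *)
have [spanK freeK] := bP C phi h' (erefl h').
have {}spanK x : exists c : 'I_n -> K, x = \sum_j sigma (c j) * chi (b j).
  have [N [c cE]] := spanK x; exists (fun j => (pi (f i) ^+ N)^-1 * c j).
  transitivity (sigma (pi (f i) ^+ N)^-1 * (sigma (pi (f i)) ^+ N * x)).
    by rewrite mulrA -(rmorphXn sigma) -(rmorphM sigma) mulVf ?expf_neq0 // rmorph1 mul1r.
  by rewrite cE mulr_sumr; apply: eq_bigr => j _; rewrite rmorphM mulrA.
have {}freeK (c : 'I_n -> K) : \sum_j sigma (c j) * chi (b j) = 0 ->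
    forall j, c j = 0.
  move=> /freeK[N cN] j; have /eqP := cN j.
  by rewrite mulf_eq0 expf_eq0 (negPf fi0) andbF => /eqP.
have chi_surj x : exists y, chi y = x.
  have [c ->] := spanK x; have /choice[d dE] := fun j => pi_surj (c j).
  exists (\sum_j rho (d j) * b j); rewrite rmorph_sum; apply: eq_bigr => j _.
  by rewrite rmorphM /= chiE dE.
pose sigmaK : {rmorphism K -> _} := GRing.RMorphism.clone C _ sigma _.
have C0 := @zero_dimensional_finite K _ sigmaK n _ spanK.
have [w [m [w1 mP]]] := line_bundle_generator (fib_pt (F _ h)) Mline C0 chi_surj.
have [N [W [WE [N' [v vE]]]]] := det_multiple w span.
exists (f i * \det W); last first.
  (* As [chi w = 1], the equations defining [W] become trivial in the fibre, and uniqueness of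
     coordinates forces [W] to reduce to a scalar matrix with nonzero determinant. *)
  suff WN : map_mx pi W = (pi (f i) ^+ N)%:M.
    by rewrite rmorphM -det_map_mx WN det_scalar mulf_neq0 // !expf_neq0.
  apply/matrixP => j l; rewrite !mxE; apply/eqP; rewrite -subr_eq0; apply/eqP.
  move: l; apply: (freeK (fun l => pi (W j l) - (pi (f i) ^+ N) *+ (j == l))).
  have := congr1 chi (WE j); rewrite rmorph_sum !rmorphM rmorphXn /= w1 mul1r.
  rewrite chiE => /eqP; rewrite eq_sym -subr_eq0 => /eqP {2}<-.
  under eq_bigr do rewrite rmorphB mulrBl.
  rewrite sumrB; congr (_ - _).
    by apply: eq_bigr => l _; rewrite rmorphM /= chiE.
  rewrite (bigD1 j) //= eqxx mulr1n rmorphXn big1 ?addr0 // => l /negPf lj.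
  by rewrite eq_sym lj mulr0n rmorph0 mul0r.
exists (fun j => (b j : fib_alg (F _ h)) *: m) => A' psi y e.
have [span' free'] := bP A' psi y e.
have [mspan mfree] := mP _ (fib_map Hp e) _ (fib_map_pt Hp e).
pose rho' := fib_str (F _ y); pose theta := fib_map Hp e.
have thetaE a : theta (rho a) = rho' (psi a).
  by have /(congr1 (fun g : kHom _ _ => g a)) := fib_map_str Hp e.
have bmE j : mres (push Hp M) e ((b j : fib_alg (F _ h)) *: m) =
    theta (b j) *: mres M (fib_map_pt Hp e) m by exact: (mresZ (fib_map_pt Hp e)).
have sumE (c : 'I_n -> A') :
    \sum_j rho' (c j) *: (mres (push Hp M) e ((b j : fib_alg (F _ h)) *: m)
      : M _ (fib_pt (F _ y))) =
    (\sum_j rho' (c j) * theta (b j)) *: mres M (fib_map_pt Hp e) m.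
  by rewrite scaler_suml; apply: eq_bigr => j _; rewrite bmE scalerA.
have wv : theta w * theta v = rho' (psi (f i * \det W)) ^+ N'.
  by rewrite -rmorphM -vE rmorphXn /= thetaE.
apply/(basis_away_restr rho'); split=> [x|c].
  have [d dE] := mspan x; have [N1 [c cE]] := span' (theta v * d).
  (* The power [N'] of [f i * \det W] supplies the factor [w * v]; the power [N1] expands
     [theta v * d] in the [b j], which uses only [f i], so its share of [\det W] goes into the
     coefficients. *)
  exists (N1 + N')%N, (fun j => psi (\det W) ^+ N1 * c j); rewrite sumE.
  rewrite exprD -wv -[_ * theta v]mulrC mulrA -scalerA dE scalerA; congr (_ *: _).
  transitivity (rho' (psi (\det W)) ^+ N1 * (rho' (psi (f i)) ^+ N1 * (theta v * d))).
    by rewrite !rmorphM exprMn /=; ring.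
  rewrite cE mulr_sumr; apply: eq_bigr => j _.
  by rewrite rmorphM rmorphXn mulrA.
(* Multiplying by [v] replaces [w] by a power of [f i * \det W] coming from the base, which can be
   absorbed into the coefficients [c j]. *)
rewrite sumE => /mfree /(congr1 (fun x => theta v * x)); rewrite mulr0.
rewrite mulrC -mulrA wv mulrC mulr_sumr => c0.
have [N1 c1] : exists N1, forall j,
    psi (f i) ^+ N1 * (psi (f i * \det W) ^+ N' * c j) = 0.
  apply: free'; rewrite -[RHS]c0; apply: eq_bigr => j _.
  by rewrite rmorphM rmorphXn mulrA.
exists (N1 + N')%N => j.
transitivity (psi (\det W) ^+ N1 *
  (psi (f i) ^+ N1 * (psi (f i * \det W) ^+ N' * c j))).
  by rewrite exprD !rmorphM exprMn /=; ring.
by rewrite c1 mulr0.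
Qed.

(** * Base change of finite flat morphisms *)

Lemma pull_vector_bundle (k : fieldType) (X Y : kfun k) (q : kmor X Y)
    (M : omod Y) n :
  vector_bundle n M -> vector_bundle n (pull q M).
Proof.
move=> Mb A x; have [r [f [f1 fP]]] := Mb A (q A x).
exists r, f; split=> // i; have [b bP] := fP i.
by exists b => B phi y e; exact: bP (pull_pt q e).
Qed.

Lemma fib_ext (k : fieldType) (Z H : kfun k) (p : kmor Z H) (A : kAlg k)
    (h : H A) (F : affine_fibre p h) (C : kAlg k) (chi chi' : kHom (fib_alg F) C) :
  kcomp chi (fib_str F) = kcomp chi' (fib_str F) ->
  ptmap chi (fib_pt F) = ptmap chi' (fib_pt F) -> chi = chi'.
Proof.
move=> e e'; have chiE : p _ (ptmap chi' (fib_pt F)) = ptmap (kcomp chi' (fib_str F)) h.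
  by rewrite mor_nat fib_over ptmap_comp.
by have [chi0 [_ u]] := fib_univ F chiE; rewrite -(u chi) // -(u chi').
Qed.

Section CartesianSquare.
Variables (k : fieldType) (Z Z' H H' : kfun k) (p : kmor Z H) (p' : kmor Z' H').
Variables (u : kmor H H') (v : kmor Z Z').
Hypothesis pv : forall A z, p' A (v A z) = u A (p A z).
Hypothesis cart : forall A h z', p' A z' = u A h ->
  exists! z, p A z = h /\ v A z = z'.

Lemma cartesian_inj A z1 z2 :
  p A z1 = p A z2 -> v A z1 = v A z2 -> z1 = z2.
Proof.
by move=> e e'; have [z [_ uz]] := cart (pv z1); rewrite -(uz z1) // -(uz z2).
Qed.

(** The fibre of [p] over [h] is represented by the algebra of the fibre of [p'] over [u h]. *)
Lemma cartesian_affine : affine_mor p' -> affine_mor p.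
Proof.
move=> Hp' A h; have [F _] := Hp' A (u A h).
have e : p' _ (fib_pt F) = u _ (ptmap (fib_str F) h).
  by rewrite fib_over mor_nat.
have [z [[pz vz] _]] := cart e.
have univ C (psi : kHom A C) (w : Z C) : p _ w = ptmap psi h ->
    exists! chi : kHom (fib_alg F) C,
      kcomp chi (fib_str F) = psi /\ ptmap chi z = w.
  move=> pw; have e' : p' _ (v _ w) = ptmap psi (u _ h).
    by rewrite pv pw mor_nat.
  have [chi [[chi_str chi_pt] chi_uniq]] := fib_univ F e'; exists chi; split.
    split=> //; apply: cartesian_inj.
      by rewrite mor_nat pz -ptmap_comp chi_str.
    by rewrite mor_nat vz.
  by move=> chi' [e1 e2]; apply: chi_uniq; rewrite -vz -mor_nat e2.
by exists (AffineFibre pz univ).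
Qed.

(** Fibre algebras are chosen independently for [p] and [p']; the two universal properties identify
    them. *)
Lemma cartesian_fibre A (h : H A) (F : affine_fibre p h)
    (F' : affine_fibre p' (u A h)) :
  exists (theta : kHom (fib_alg F') (fib_alg F)),
    [/\ kcomp theta (fib_str F') = fib_str F,
        ptmap theta (fib_pt F') = v _ (fib_pt F) &
        exists eta : kHom (fib_alg F) (fib_alg F'),
          cancel theta eta /\ cancel eta theta].
Proof.
have e1 : p' _ (v _ (fib_pt F)) = ptmap (fib_str F) (u _ h).
  by rewrite pv fib_over mor_nat.
have [theta [[theta_str theta_pt] _]] := fib_univ F' e1.
have e2 : p' _ (fib_pt F') = u _ (ptmap (fib_str F') h).
  by rewrite fib_over mor_nat.
have [z [[pz vz] _]] := cart e2.
have [eta [[eta_str eta_pt] _]] := fib_univ F pz.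
exists theta; split=> //; exists eta.
have c1 : kcomp eta theta = kid _.
  apply: fib_ext; first by rewrite spec_comp theta_str eta_str spec_id.
  by rewrite ptmap_comp theta_pt -mor_nat eta_pt ptmap_id.
have c2 : kcomp theta eta = kid _.
  apply: fib_ext; first by rewrite spec_comp eta_str theta_str spec_id.
  rewrite ptmap_comp eta_pt ptmap_id; apply: cartesian_inj.
    by rewrite mor_nat pz -ptmap_comp theta_str fib_over.
  by rewrite mor_nat vz.
by split=> x; [have /(congr1 (fun g : kHom _ _ => g x)) := c1
              | have /(congr1 (fun g : kHom _ _ => g x)) := c2].
Qed.

Lemma cartesian_finite_flat n : finite_flat n p' -> finite_flat n p.
Proof.
case=> Hp' free'; exists (cartesian_affine Hp') => A h.
set Hp := cartesian_affine Hp'.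
have [r [f [f1 fP]]] := free' A (u A h); exists r, f; split=> // i.
have [b bP] := fP i.
have [theta [theta_str theta_pt _]] := cartesian_fibre (fib Hp h) (fib Hp' (u A h)).
exists (fun j => theta (b j)) => B phi y e.
have e' : ptmap phi (u A h) = u B y by rewrite -mor_nat e.
have [theta' [theta'_str theta'_pt [eta [thetaK etaK]]]] :=
  cartesian_fibre (fib Hp y) (fib Hp' (u B y)).
(* The identifications of fibres commute with base change, so the transported basis stays a basis
   after every [phi]. *)
have comm : kcomp (fib_map Hp e) theta = kcomp theta' (fib_map Hp' e').
  apply: fib_ext.
    by rewrite spec_comp theta_str fib_map_str spec_comp fib_map_str -spec_comp
      theta'_str.
  by rewrite !ptmap_comp theta_pt -mor_nat !fib_map_pt theta'_pt.
have bE j : fib_map Hp e (theta (b j)) = theta' (fib_map Hp' e' (b j)).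
  by have /(congr1 (fun g : kHom _ _ => g (b j))) := comm.
have strE a : fib_str (fib Hp y) a = theta' (fib_str (fib Hp' (u B y)) a).
  by rewrite -theta'_str.
have [span free] := (basis_away_restr _ _ _).1 (bP B phi (u B y) e').
have sumE (c : 'I_n -> B) :
    \sum_j fib_str (fib Hp y) (c j) * fib_map Hp e (theta (b j)) =
    theta' (\sum_j fib_str (fib Hp' (u B y)) (c j) * fib_map Hp' e' (b j)).
  by rewrite rmorph_sum; apply: eq_bigr => j _; rewrite rmorphM /= -strE bE.
apply/basis_away_restr; split=> [x|c].
  have [N [c cE]] := span (eta x); exists N, c.
  transitivity (theta' (fib_str (fib Hp' (u B y)) (phi (f i)) ^+ N * eta x)).
    by rewrite rmorphM rmorphXn /= -strE etaK.
  by rewrite [X in theta' X]cE -sumE.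
move=> /(etrans (esym (sumE c)))/(congr1 eta); rewrite thetaK rmorph0.
exact: free.
Qed.
End CartesianSquare.

(** * Families of subschemes *)

Lemma kHom_factor (k : fieldType) (A B C : kAlg k) (pi : kHom A C)
    (psi : kHom A B) :
  (forall c, exists a, pi a = c) -> (forall a, pi a = 0 -> psi a = 0) ->
  exists chi : kHom C B, kcomp chi pi = psi.
Proof.
move=> /choice[s sK] ker.
have psiE a a' : pi a = pi a' -> psi a = psi a'.
  by move=> e; apply/eqP; rewrite -subr_eq0 -rmorphB /= ker // rmorphB /= e subrr.
have chiB : zmod_morphism (fun c => psi (s c)).
  by move=> c d; rewrite -rmorphB; apply: psiE; rewrite rmorphB /= !sK.
have chiM : monoid_morphism (fun c => psi (s c)).
  split=> [|c d]; first by rewrite -(rmorph1 psi); apply: psiE; rewrite sK rmorph1.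
  by rewrite -rmorphM; apply: psiE; rewrite rmorphM /= !sK.
have chi_str c : psi (s (kAlg_str C c)) = kAlg_str B c.
  by rewrite -(kHom_str psi); apply: psiE; rewrite sK kHom_str.
by exists (KHom chiB chiM chi_str); apply: kHom_eq => a; apply: psiE; rewrite sK.
Qed.

Lemma kAlg_quotient (k : fieldType) (A : kAlg k) (I : A -> Prop) : is_ideal I ->
  exists (C : kAlg k) (pi : kHom A C),
    (forall c, exists a, pi a = c) /\ forall a, pi a = 0 <-> I a.
Proof.
move=> /quotient_ring[Q [pi [pi_surj pi0]]].
pose C : kAlg k := KAlg (pi \o kAlg_str A : {rmorphism k -> Q}).
by exists C, (@KHom k A C pi (rmorphB pi) (conj (rmorph1 pi) (rmorphM pi))
  (fun=> erefl)).
Qed.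

Lemma is_ideal_ideal_of (k : fieldType) (X : kfun k) (D : sub X) (A : kAlg k)
    (x : X A) : is_ideal (ideal_of D x).
Proof.
split=> [B phi _|a u v Iu Iv B phi DB]; first exact: rmorph0.
by rewrite rmorphD rmorphM /= Iu // Iv // mulr0 addr0.
Qed.

(** The equations supplied by closedness need not form an ideal, but they lie in [ideal_of D x],
    which cuts out the same subscheme and by which a quotient can be taken. *)
Lemma closed_sub_ideal_of (k : fieldType) (X : kfun k) (D : sub X) (A : kAlg k)
    (x : X A) (B : kAlg k) (phi : kHom A B) :
  closed_sub D -> D B (ptmap phi x) <-> forall a, ideal_of D x a -> phi a = 0.
Proof.
move=> /(_ A x)[I IP]; split=> [Dx a|kill]; first exact.
by apply/IP => a Ia; apply: kill => C psi /IP; exact.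
Qed.

Definition idmor (k : fieldType) (X : kfun k) : kmor X X :=
  @KMor k X X (fun A x => x) (fun A B f x => erefl).

Section SubConstructions.
Variables (k : fieldType) (H Y : kfun k).

Section Extension.
Variables (D : sub Y) (W : sub (kprod H (sfun D))).

Definition extend_pred (A : kAlg k) (x : kprod H Y A) : Prop :=
  exists Dx : D A x.2, W A (x.1, exist _ x.2 Dx).
Lemma extend_stable A B (f : kHom A B) (x : kprod H Y A) :
  extend_pred x -> extend_pred (ptmap f x).
Proof.
case=> Dx Wx; exists (sub_stable f (svalP (exist (D A) _ Dx))).
exact: (sub_stable f Wx).
Qed.
Definition extend : sub (kprod H Y) := Defs.Sub extend_stable.

(** A composite of closed immersions: the quotient [C] of [A] is the locus where [y] lies in [D],
    and the equations [J] of [W] over [C] are pulled back to [A] and added to those of [D]. *)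
Lemma closed_extend : closed_sub D -> closed_sub W -> closed_sub extend.
Proof.
move=> Dcl Wcl A [t y].
have [C [pi [pi_surj pi0]]] := kAlg_quotient (is_ideal_ideal_of D y).
have Dpi : D C (ptmap pi y) by apply/closed_sub_ideal_of => // a /pi0.
have [J JP] := Wcl C (ptmap pi t, exist _ (ptmap pi y) Dpi).
have WE (B : kAlg k) (chi : kHom C B) (psi : kHom A B) :
    kcomp chi pi = psi ->
    extend B (ptmap psi ((t, y) : kprod H Y A)) <-> forall c, J c -> chi c = 0.
  move=> <-; rewrite -JP.
  have ptE Dy : ((ptmap (kcomp chi pi) t, exist _ (ptmap (kcomp chi pi) y) Dy)
      : kprod H (sfun D) B) =
      ptmap chi ((ptmap pi t, exist _ (ptmap pi y) Dpi) : kprod H (sfun D) C).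
    by rewrite /= /prod_map /=; congr (_, _); [|apply: sfun_eq]; exact: ptmap_comp.
  split=> [[Dy Wy]|Wy]; first by rewrite -(ptE Dy).
  have Dy : D B (ptmap (kcomp chi pi) y).
    by rewrite ptmap_comp; exact: (sub_stable chi Dpi).
  by exists Dy; rewrite -(ptE Dy) in Wy.
exists (fun a => ideal_of D y a \/ J (pi a)) => B psi; split=> [Wy a|kill].
  have [Dy _] := Wy.
  have psi0 b : pi b = 0 -> psi b = 0 by move=> /pi0; exact.
  have [chi chiE] := kHom_factor pi_surj psi0.
  case=> [Ia|Ja]; first exact/psi0/pi0.
  by rewrite -chiE; exact: (WE _ _ _ chiE).1.
have psi0 b : pi b = 0 -> psi b = 0 by move=> /pi0 Ib; apply: kill; left.
have [chi chiE] := kHom_factor pi_surj psi0.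
apply/(WE _ _ _ chiE) => c; have [a <-] := pi_surj c => Ja.
have -> : chi (pi a) = psi a by rewrite -chiE.
by apply: kill; right.
Qed.

(** [extend] and [W] have the same total space over [H], so finite flatness passes along a cartesian
    square over the identity of [H]. *)
Lemma family_extend n : closed_sub D -> Defs.family n W -> Defs.family n extend.
Proof.
move=> Dcl [Wcl flat]; split; first exact: closed_extend.
pose Dpt A (z : sfun extend A) : D A (sval z).2 :=
  let: ex_intro Dx _ := svalP z in Dx.
have Wpt A (z : sfun extend A) : W A ((sval z).1, exist _ (sval z).2 (Dpt A z)).
  by have [Dx Wx] := svalP z; rewrite (Prop_irrelevance (Dpt A z) Dx).
pose v_fun A (z : sfun extend A) : sfun W A := exist _ _ (Wpt A z).
have v_nat A B (f : kHom A B) (z : sfun extend A) :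
    v_fun B (ptmap f z) = ptmap f (v_fun A z).
  by apply: sfun_eq; congr (_, _); apply: sfun_eq.
apply: (cartesian_finite_flat (u := idmor H) (v := KMor v_nat)) flat => //.
move=> A h [[t [y Dy]] Wy] /= th.
exists (exist _ (t, y) (ex_intro _ Dy Wy) : sfun extend A); split.
  by split=> //; apply: (sfun_eq (D := W)); congr (_, _); apply: sfun_eq.
by move=> [[t' y'] Wy'] [_ e2]; apply: (sfun_eq (D := extend)); case: e2 => /= -> ->.
Qed.
End Extension.

Section Restriction.
Variables (D : sub Y) (W : sub (kprod H Y)).
Definition restrict_pred (A : kAlg k) (x : kprod H (sfun D) A) : Prop :=
  W A (x.1, sval x.2).
Lemma restrict_stable A B (f : kHom A B) (x : kprod H (sfun D) A) :
  restrict_pred x -> restrict_pred (ptmap f x).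
Proof. exact: (sub_stable f). Qed.
Definition restrict : sub (kprod H (sfun D)) := Defs.Sub restrict_stable.

Lemma family_restrict n : (forall A t y, W A (t, y) -> D A y) ->
  Defs.family n W -> Defs.family n restrict.
Proof.
move=> WD [Wcl flat]; split=> [A [t [y Dy]]|].
  by have [I IP] := Wcl A (t, y); exists I => B phi; exact: IP.
pose v_fun A (z : sfun restrict A) : sfun W A :=
  exist _ ((sval z).1, sval (sval z).2) (svalP z).
have v_nat A B (f : kHom A B) (z : sfun restrict A) :
    v_fun B (ptmap f z) = ptmap f (v_fun A z) by exact: (sfun_eq (D := W)).
apply: (cartesian_finite_flat (u := idmor H) (v := KMor v_nat)) flat => //.
move=> A h [[t y] Wy] /= th.
exists (exist _ (t, exist _ y (WD _ _ _ Wy)) Wy : sfun restrict A); split.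
  by split=> //; apply: (sfun_eq (D := W)).
move=> [[t' [y' Dy']] Wy'] [_ e2]; apply: (sfun_eq (D := restrict)).
by case: e2 => /= tt' yy'; congr (_, _) => //; apply: sfun_eq.
Qed.
End Restriction.

Section BaseChange.
Variables (W : sub (kprod H Y)) (A0 : kAlg k) (h : H A0).
Definition base_pred (A : kAlg k) (x : kprod (Spec A0) Y A) : Prop :=
  W A (ptmap x.1 h, x.2).
Lemma base_stable A B (f : kHom A B) (x : kprod (Spec A0) Y A) :
  base_pred x -> base_pred (ptmap f x).
Proof. by rewrite /base_pred /= ptmap_comp; exact: (sub_stable f). Qed.
Definition base_change : sub (kprod (Spec A0) Y) := Defs.Sub base_stable.

Lemma family_base_change n : Defs.family n W -> Defs.family n base_change.
Proof.
move=> [Wcl flat]; split=> [A [t y]|].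
  have [I IP] := Wcl A (ptmap t h, y); exists I => B phi.
  by rewrite -IP /= /base_pred /= ptmap_comp.
pose u : kmor (Spec A0) H := @KMor k (Spec A0) H (fun A x => ptmap x h)
  (fun A B f x => ptmap_comp f x h).
pose v_fun A (z : sfun base_change A) : sfun W A :=
  exist _ (ptmap (sval z).1 h, (sval z).2) (svalP z).
have v_nat A B (f : kHom A B) (z : sfun base_change A) :
    v_fun B (ptmap f z) = ptmap f (v_fun A z).
  by apply: (sfun_eq (D := W)); rewrite /= ptmap_comp.
apply: (cartesian_finite_flat (u := u) (v := KMor v_nat)) flat => //.
move=> A phi [[t y] Wy] /= th; move: Wy; rewrite th => Wy.
exists (exist _ (phi, y) Wy : sfun base_change A); split.
  by split=> //; apply: (sfun_eq (D := W)).
by move=> [[t' y'] Wy'] [/= tt' [_ yy']]; apply: (sfun_eq (D := base_change));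
  rewrite /= tt' yy'.
Qed.
End BaseChange.
End SubConstructions.

Lemma bijective_iso (k : fieldType) (X Y : kfun k) (f : kmor X Y) :
  (forall A, injective (f A)) -> (forall A y, exists x, f A x = y) -> is_iso f.
Proof.
move=> f_inj f_surj.
pose g A (y : Y A) : X A := sval (cid (f_surj A y)).
have gK A (y : Y A) : f A (g A y) = y by rewrite /g; case: cid.
have g_nat A B (phi : kHom A B) (y : Y A) : g B (ptmap phi y) = ptmap phi (g A y).
  by apply: f_inj; rewrite mor_nat !gK.
by exists (KMor g_nat); split=> // A x; apply: f_inj; rewrite /= gK.
Qed.

(** * The zero locus of the tautological section *)

Section DivisorHilbert.
Variables (k : fieldType) (X : kfun k) (D : sub X) (L : omod X) (s : section L).
Variables (n : nat) (HX HD : kfun k).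
Variables (ZX : sub (kprod HX X)) (ZD : sub (kprod HD (sfun D))).
Hypotheses (Dcl : closed_sub D) (sD : defines D s).
Hypotheses (hilbX : is_hilbert n ZX) (hilbD : is_hilbert n ZD).

(** The family in [D] classified by [h], regarded as a family in [X], is classified by [x]. *)
Lemma hilbert_push_ex A (h : HD A) : exists x : HX A,
  forall (B : kAlg k) (phi : kHom A B) (y : X B),
    ZX B (ptmap phi x, y) <-> exists Dy : D B y, ZD B (ptmap phi h, exist _ y Dy).
Proof.
have [x [xP _]] := hilb_univ hilbX
  (family_extend Dcl (family_base_change h (hilb_family hilbD))).
by exists x => B phi y; rewrite -xP.
Qed.

(** Both points classify the pullback of the universal family along [x], so uniqueness applies. *)
Lemma hilbert_inj (H Y : kfun k) (Z : sub (kprod H Y)) (hilb : is_hilbert n Z)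
    A (x x' : H A) :
  (forall (B : kAlg k) (phi : kHom A B) (y : Y B),
     Z B (ptmap phi x, y) <-> Z B (ptmap phi x', y)) -> x = x'.
Proof.
move=> e; have [x0 [_ uniq]] :=
  hilb_univ hilb (family_base_change x (hilb_family hilb)).
by rewrite -(uniq x) // -(uniq x').
Qed.

(** The value of the tautological section at [x] is [s] at the universal point of the fibre, and its
    vanishing puts that point in [D]. Every point of the family is an image of the universal one. *)
Lemma zero_locusP A (x : HX A) :
  zero_locus (taut_section hilbX s) A x <->
  forall (B : kAlg k) (phi : kHom A B) (y : X B), ZX B (ptmap phi x, y) -> D B y.
Proof.
set F := fib (hilb_affine hilbX) x.
have -> : zero_locus (taut_section hilbX s) A x <-> D _ (sval (fib_pt F)).2.
  exact: (sD (sval (fib_pt F)).2).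
split=> [DF B phi y Zy|DZ].
  pose z : sfun ZX B := exist _ (ptmap phi x, y) Zy.
  have [chi [[_ chi_pt] _]] := fib_univ F (erefl : pr1 ZX B z = ptmap phi x).
  have <- : (sval (ptmap chi (fib_pt F))).2 = y by rewrite chi_pt.
  exact: (sub_stable chi DF).
apply: (DZ _ (fib_str F)); have <- := fib_over F.
by case: (fib_pt F) => -[].
Qed.

Lemma hilbert_divisor_zero_locus :
  exists f : kmor HD (sfun (zero_locus (taut_section hilbX s))),
    is_iso f /\
    forall (A : kAlg k) (h : HD A) (B : kAlg k) (phi : kHom A B) (x : X B),
      ZX B (ptmap phi (sval (f A h)), x) <->
      exists Dx : D B x, ZD B (ptmap phi h, exist _ x Dx).
Proof.
pose g A (h : HD A) : HX A := sval (cid (hilbert_push_ex h)).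
have gP A (h : HD A) (B : kAlg k) (phi : kHom A B) (y : X B) :
    ZX B (ptmap phi (g A h), y) <->
    exists Dy : D B y, ZD B (ptmap phi h, exist _ y Dy).
  by rewrite /g; case: cid.
have g0 A (h : HD A) : zero_locus (taut_section hilbX s) A (g A h).
  by apply/zero_locusP => B phi y /gP[].
pose f_fun A (h : HD A) : sfun (zero_locus (taut_section hilbX s)) A :=
  exist _ (g A h) (g0 A h).
have f_nat A B (phi : kHom A B) (h : HD A) :
    f_fun B (ptmap phi h) = ptmap phi (f_fun A h).
  apply: (sfun_eq (D := zero_locus (taut_section hilbX s))) => /=.
  by apply: (hilbert_inj hilbX) => C psi y; rewrite -ptmap_comp !gP ptmap_comp.
exists (KMor f_nat); split; last exact: gP.
apply: bijective_iso => [A h h' /(congr1 sval)/= ghh'|A [x x0]].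
  have ZE (B : kAlg k) (phi : kHom A B) (y : sfun D B) h1 :
      ZD B (ptmap phi h1, y) <-> ZX B (ptmap phi (g A h1), sval y).
    case: y => y Dy; rewrite gP; split=> [|[Dy' Zy]]; first by exists Dy.
    by rewrite (Prop_irrelevance Dy Dy').
  by apply: (hilbert_inj hilbD) => B phi y; rewrite !ZE ghh'.
(* For surjectivity: the family of [x] lies in [D], so it restricts to a family on [D], and [h]
   classifies it. *)
have DZ := (zero_locusP x).1 x0.
have [h [hP _]] := hilb_univ hilbD (family_restrict
  (D := D) (W := base_change ZX x) (fun B phi y => DZ B phi y)
  (family_base_change x (hilb_family hilbX))).
exists h; apply: (sfun_eq (D := zero_locus (taut_section hilbX s))) => /=.
apply: (hilbert_inj hilbX) => B phi y; rewrite gP; split=> [[Dy /hP]//|Zy].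
by exists (DZ _ _ _ Zy); apply/hP.
Qed.
End DivisorHilbert.

Lemma taut_vector_bundle (k : fieldType) (X : kfun k) (L : omod X) (n : nat)
    (H : kfun k) (Z : sub (kprod H X)) (hilb : is_hilbert n Z) :
  line_bundle L -> vector_bundle n (taut hilb L).
Proof.
move=> Lline; have [_ [Hp free]] := hilb_family hilb.
(* The fibre algebras in the pushforward are extracted from the proof of affineness; proof
   irrelevance makes the two choices agree. *)
rewrite /taut (Prop_irrelevance (hilb_affine hilb) Hp).
exact: push_line_bundle free (pull_vector_bundle _ Lline).
Qed.

Theorem proposition1p3 (R : realType) (X : kfun (complex R)) (D : sub X)
    (L : omod X) (s : section L) (n : nat)
    (HX HD : kfun (complex R))
    (ZX : sub (kprod HX X)) (ZD : sub (kprod HD (sfun D)))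
    (Xvar : variety X) (Xqp : quasi_projective X) (Xsm : smooth X)
    (Deff : effective_divisor D)
    (Lline : line_bundle L) (LOD : is_O_of_divisor D L) (sD : defines D s)
    (n_gt0 : (0 < n)%N)
    (hilbX : is_hilbert n ZX) (hilbD : is_hilbert n ZD) :
  vector_bundle n (taut hilbX L) /\
  exists f : kmor HD (sfun (zero_locus (taut_section hilbX s))),
    is_iso f /\
    forall (A : kAlg (complex R)) (h : HD A) (B : kAlg (complex R))
      (phi : kHom A B) (x : X B),
      ZX B (ptmap phi (sval (f A h)), x) <->
      exists Dx : D B x, ZD B (ptmap phi h, exist _ x Dx).
Proof.
split; first exact: taut_vector_bundle.
exact: hilbert_divisor_zero_locus Deff.1 sD hilbX hilbD.
Qed.
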